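(* Let $q>2$ be even and let $\mathcal{E}$ be a set of solids (hyperplanes) of $\mathrm{PG}(4,q)$ such that (I) every point of $\mathrm{PG}(4,q)$ lies in either $0$, $\frac12q^3$ or $\frac12(q^3-q^2)$ solids of $\mathcal{E}$, and (II) every plane of $\mathrm{PG}(4,q)$ lies in either $0$, $\frac12q$ or $q$ solids of $\mathcal{E}$. Then either $\mathcal{E}$ is the set of solids of $\mathrm{PG}(4,q)$ that are disjoint from some hyperoval (contained in a plane of $\mathrm{PG}(4,q)$), or $\mathcal{E}$ is the set of solids of $\mathrm{PG}(4,q)$ that meet some non-singular quadric $Q(4,q)$ in an elliptic quadric.
   Context: A solid of $\mathrm{PG}(4,q)$ is a hyperplane (a 3-dimensional projective subspace). A hyperoval of a projective plane $\mathrm{PG}(2,q)$, $q$ even, is a set of $q+2$ points no three collinear. $Q(4,q)$ denotes a non-singular quadric of $\mathrm{PG}(4,q)$.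
   Formalization: The set of solids is additionally assumed to be nonempty: the empty set satisfies (I) and (II), but every hyperoval has disjoint solids and every Q(4,q) has solids meeting it in an elliptic quadric, so the claim fails for it. *)

(* Defs.v *)
From HB Require Import structures.
From mathcomp Require Export all_boot all_order all_algebra.

Set Implicit Arguments.
Unset Strict Implicit.
Unset Printing Implicit Defensive.

Import GRing.Theory VectorInternalTheory.
Local Open Scope ring_scope.

HB.instance Definition _ (F : finFieldType) (vT : vectType F) :=
  [Countable of {vspace vT} by <:].
HB.instance Definition _ (F : finFieldType) (vT : vectType F) :=
  [Finite of {vspace vT} by <:].

(* PG(n, q) is the lattice of subspaces of 'rV[F]_n.+1 with #|F| = q; a        *)
(* subspace of projective dimension d has \dim equal to d.+1.                 *)
Section ProjectiveGeometry.

Variables (F : finFieldType) (n : nat).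
Notation V := 'rV[F]_n.+1.
Implicit Types (P L U W : {vspace V}) (X H : {set {vspace V}}).

Definition point U := \dim U == 1%N.
Definition line U := \dim U == 2%N.
Definition plane U := \dim U == 3%N.
Definition solid U := \dim U == 4%N.

Definition section X U := [set P in X | (P <= U)%VS].

Definition collinear P1 P2 P3 :=
  exists2 L, line L & [/\ (P1 <= L)%VS, (P2 <= L)%VS & (P3 <= L)%VS].

Definition hyperoval W H :=
  [/\ plane W,
      {in H, forall P, point P && (P <= W)%VS},
      #|H| = (#|F| + 2)%N
    & {in H & &, forall P1 P2 P3,
        uniq [:: P1; P2; P3] -> ~ collinear P1 P2 P3}].

Implicit Type Q : V -> F.

Definition polar Q (u v : V) : F := Q (u + v) - Q u - Q v.

Definition quadratic_form Q :=
  (forall a v, Q (a *: v) = a ^+ 2 * Q v) /\ (forall u, scalar (polar Q u)).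

(* In characteristic 2 the polar form of a nonsingular form may be degenerate *)
(* (it always is in odd vector dimension), so only the zeros of Q in its      *)
(* radical are excluded.                                                      *)
Definition nonsingular_on U Q :=
  forall v, v \in U -> Q v = 0 -> (forall u, u \in U -> polar Q v u = 0) ->
  v = 0.

Definition totally_singular Q W := [forall v, (v \in W) ==> (Q v == 0)].

Definition witt_index U Q : nat :=
  \max_(W : {vspace V} | (W <= U)%VS && totally_singular Q W) \dim W.

Definition quadric U Q := [set P | [&& point P, (P <= U)%VS & totally_singular Q P]].

Definition nonsingular_quadric X :=
  exists Q, [/\ quadratic_form Q, nonsingular_on fullv Q & X = quadric fullv Q].

(* Every quadratic form on U is the restriction of one on V. For a            *)
(* nonsingular form on a solid the Witt index is 1 (elliptic) or              *)
(* 2 (hyperbolic).                                                            *)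
Definition elliptic_quadric U X :=
  solid U /\
  exists Q, [/\ quadratic_form Q, nonsingular_on U Q, witt_index U Q = 1%N
              & X = quadric U Q].

End ProjectiveGeometry.

(* Main.v *)
From mathcomp Require Import finfield zify ring.
Require Import Defs.

Set Implicit Arguments.
Unset Strict Implicit.
Unset Printing Implicit Defensive.

Import GRing.Theory.
Local Open Scope ring_scope.

(* Identify solids with their normal vectors, so that E becomes a set A of    *)
(* vectors which meets lines of the dual space in 0, q/2 or q points and      *)
(* hyperplanes in 0, (q^3 - q^2)/2 or q^3/2 points.  Fix P in A.  Counting    *)
(* along the lines through P, a hyperplane on P contains 1 or q + 1 of the    *)
(* R lines on P that meet A in q points; first and second moments over these  *)
(* hyperplanes make R a root of (R - q - 1)(R - q^2 - 1), and the moments     *)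
(* over all hyperplanes then count those missing A.                           *)
(* If R = q + 1, these q lines fill a plane on P, whose points outside A form *)
(* a line l lying in all q + 2 hyperplanes that miss A; l does not depend on  *)
(* P, and these hyperplanes form the dual of the required hyperoval.          *)
(* If R = q^2 + 1, exactly one hyperplane nu misses A.  Call a hyperplane     *)
(* singular if it has (q^3 - q^2)/2 points.  A pencil of hyperplanes with nu  *)
(* has one singular member, so vectors f have a unique height t with          *)
(* f + t nu singular or zero; any other pencil has 0, 1, 2 or q + 1 singular  *)
(* members.  The pencils of q + 1 singular members on a given singular v are  *)
(* those in a hyperplane, the polar of the point where a q-line of A in v     *)
(* meets nu.  Hence D(x, y) = height(x + y) + height x + height y vanishes,   *)
(* for fixed x, on a hyperplane in y, which forces D^2 to be bilinear;        *)
(* height^2 is the required quadratic form.                                   *)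

(** * The dot product and double counts over subspaces *)

(** Counting separates the two cases. [full P] collects the vectors on the R lines through P that
    carry q points of A. Its intersection sizes with the hyperplanes on P determine its first two
    moments, which leave R = q + 1 or R = q^2 + 1 ([card_full]). This fixes the size of A ([card_A])
    and the number of hyperplanes missing A ([card_zeros]).

    If R = q + 1, the hyperplanes missing A share a line ([common_vertex]). First moments over a
    pencil show that every point outside A is on one of them ([zero_perp]) and that no three of them
    form part of a pencil ([zeros_no_line]). Dually, this is a hyperoval.

    If R = q^2 + 1, [height] is built as the square root of the future form, and
    [tangent_hyperplane] says that its defect D(x, y) vanishes, for fixed x, on a hyperplane. From
    this alone D is invariant under transvections ([defect_transvection]), hence additive
    ([defectDr]) and semilinear for the square root ([defectZr]), so D^2 is bilinear. Lines of
    singular points have an [orth] disjoint from A. So the solid of a in A contains none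
    ([singular_subspace_disjoint]), the solid of any other a contains one ([nonelliptic_line]), and
    the Witt index recognizes A. *)

Section Orthogonality.

Variables (F : finFieldType) (n : nat).
Notation V := 'rV[F]_n.
Implicit Types (x y z : V) (M U W : {vspace V}) (B : {set V}).

Definition dot x y : F := \sum_i x 0 i * y 0 i.

Lemma dotC x y : dot x y = dot y x.
Proof. by apply: eq_bigr => i _; rewrite mulrC. Qed.

Lemma dotDl x y z : dot (x + y) z = dot x z + dot y z.
Proof. by rewrite -big_split; apply: eq_bigr => i _; rewrite !mxE mulrDl. Qed.

Lemma dotZl a x y : dot (a *: x) y = a * dot x y.
Proof. by rewrite mulr_sumr; apply: eq_bigr => i _; rewrite !mxE mulrA. Qed.

Lemma dotDr x y z : dot z (x + y) = dot z x + dot z y.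
Proof. by rewrite !(dotC z) dotDl. Qed.

Lemma dotZr a x y : dot y (a *: x) = a * dot y x.
Proof. by rewrite !(dotC y) dotZl. Qed.

Lemma dot0l y : dot 0 y = 0.
Proof. by rewrite -(scale0r y) dotZl mul0r. Qed.

Lemma dot0r y : dot y 0 = 0.
Proof. by rewrite dotC dot0l. Qed.

Let basis_mx U := \matrix_(i < \dim U) (vbasis U)`_i.

Let pairing U : 'Hom(V, 'rV[F]_(\dim U)) := linfun (mulmxr (basis_mx U)^T).

Definition orth U : {vspace V} := lker (pairing U).

Lemma orthP U x : reflect {in U, forall u, dot x u = 0} (x \in orth U).
Proof.
have dotE i : (x *m (basis_mx U)^T) 0 i = dot x (vbasis U)`_i.
  by rewrite mxE; apply: eq_bigr => j _; rewrite !mxE.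
rewrite memv_ker lfunE /=; apply: (iffP eqP) => [x0 u /coord_vbasis -> | xU].
  elim/big_rec: _ => [|i v _ IH]; first exact: dot0r.
  by rewrite dotDr dotZr -dotE x0 mxE mulr0 IH addr0.
apply/rowP => i; rewrite dotE mxE xU // vbasis_mem // mem_nth //.
by rewrite size_tuple.
Qed.

Lemma dim_orth U : \dim (orth U) = (n - \dim U)%N.
Proof.
have free_mx : row_free (basis_mx U).
  rewrite -kermx_eq0; apply/eqP/row_matrixP => i; rewrite row0.
  have /sub_kermxP rk0 := row_sub i (kermx (basis_mx U)).
  apply/rowP => j; rewrite [RHS]mxE.
  have /freeP fU := basis_free (vbasisP U).
  apply: (fU (fun k => row i (kermx (basis_mx U)) 0 k)).
  rewrite -[RHS]rk0 mulmx_sum_row; apply: eq_bigr => k _.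
  by congr (_ *: _); apply/rowP => l; rewrite !mxE.
have [N mxN] := row_freeP free_mx.
have fullU : limg (pairing U) = fullv.
  apply: subv_anti; rewrite subvf /=; apply/subvP => w _.
  have -> : w = pairing U (w *m N^T).
    by rewrite lfunE /= -mulmxA -trmx_mul mxN trmx1 mulmx1.
  exact: memv_img (memvf _).
have := limg_ker_dim (pairing U) fullv.
rewrite fullU capfv !dimvf /dim /= !mul1n => dimE.
by rewrite -[X in (X - _)%N]dimE addnK.
Qed.

Lemma orthS U W : (U <= W)%VS -> (orth W <= orth U)%VS.
Proof.
move=> /subvP sUW; apply/subvP => x /orthP xW.
by apply/orthP => u /sUW; apply: xW.
Qed.

Lemma orthK : involutive (@orth).
Proof.
move=> U; apply/esym/eqP; rewrite eqEdim !dim_orth.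
have le_Un : (\dim U <= n)%N.
  by rewrite (leq_trans (dimvS (subvf U))) // dimvf /dim /= mul1n.
rewrite subKn // leqnn andbT; apply/subvP => u Uu.
by apply/orthP => x /orthP xU; rewrite dotC xU.
Qed.

Lemma orthSE U W : (orth W <= orth U)%VS = (U <= W)%VS.
Proof. by apply/idP/idP => /orthS //; rewrite !orthK. Qed.

Lemma orth_inj : injective (@orth).
Proof. exact: inv_inj orthK. Qed.

Lemma orthD U W : orth (U + W) = (orth U :&: orth W)%VS.
Proof.
apply/vspaceP => x; rewrite memv_cap; apply/orthP/andP => [xUW|].
  split; apply/orthP => u uU; apply: xUW.
    exact: subvP (addvSl U W) _ uU.
  exact: subvP (addvSr U W) _ uU.
case=> /orthP xU /orthP xW _ /memv_addP[u uU [w wW ->]].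
by rewrite dotDr xU // xW // addr0.
Qed.

Lemma orth_lineE x y : (x \in orth <[y]>%VS) = (dot x y == 0).
Proof.
apply/orthP/eqP => [-> //|xy _ /vlineP[k ->]]; first exact: memv_line.
by rewrite dotZr xy mulr0.
Qed.

Lemma orth0 : orth 0 = fullv.
Proof.
apply: subv_anti; rewrite subvf; apply/subvP => x _.
by apply/orthP => u; rewrite memv0 => /eqP->; rewrite dot0r.
Qed.

Lemma dim_addv_line U x : x \notin U -> \dim (U + <[x]>) = (\dim U).+1.
Proof.
move=> xU; have x0 : x != 0 by apply: contraNneq xU => ->; apply: mem0v.
rewrite dimv_disjoint_sum ?dim_vline ?x0 ?addn1 //.
apply/eqP; rewrite -subv0; apply/subvP => w /memv_capP[wU /vlineP[k wE]].
move: wU; rewrite wE.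
have [->|k0] := eqVneq k 0; first by rewrite scale0r => _; apply: mem0v.
by rewrite rpredZeq (negPf k0) (negPf xU).
Qed.

Definition cnt B U := #|[set x in B | x \in U]|.

(** The hyperplane of x cuts U in the [orth] of [orth U + <[x]>], so the dimension drops by one
    unless x lies in [orth U]. The factor #|F| avoids a division. *)
Lemma card_orth_vec U x :
  (#|F| * #|[set y in U | y \in orth <[x]>%VS]| =
     if x \in orth U then #|F| * #|U| else #|U|)%N.
Proof.
have -> : [set y in U | y \in orth <[x]>%VS] = [set y in (U :&: orth <[x]>)%VS].
  by apply/setP => y; rewrite !inE memv_cap.
rewrite cardsE !card_vspace -[in RHS](orthK U) -[in LHS](orthK U) -orthD !orthK.
case: ifPn => xU; first by rewrite (addv_idPl _) ?orthK // -memvE.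
have := dim_orth (orth U + <[x]>); rewrite dim_addv_line // => d1.
have := dim_orth (orth U); rewrite orthK => d2.
have le_Un : (\dim (orth U + <[x]>) <= n)%N.
  by rewrite (leq_trans (dimvS (subvf _))) // dimvf /dim /= mul1n.
move: le_Un; rewrite dim_addv_line // => le_Un.
by rewrite d1 d2 -expnS -subSn.
Qed.

(** Double count of the orthogonal pairs f in U, b in B. The term in [cnt B (orth U)] stands on both
    sides to avoid subtraction in [nat]. *)
Lemma sum_cnt_orth B U :
  (#|F| * (\sum_(f in U) cnt B (orth <[f]>)) + #|U| * cnt B (orth U) =
    #|U| * #|B| + #|F| * #|U| * cnt B (orth U))%N.
Proof.
have -> : (\sum_(f in U) cnt B (orth <[f]>) =
    \sum_(b in B) #|[set f in U | f \in orth <[b]>%VS]|)%N.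
  under eq_bigr => f _ do rewrite /cnt -sum1_card.
  under [RHS]eq_bigr => b _ do rewrite -sum1_card.
  rewrite (exchange_big_dep (mem B)) => [|f b _] /=; last by rewrite inE => /andP[].
  apply: eq_bigr => b bB; apply: eq_bigl => f.
  by rewrite !inE bB !orth_lineE dotC.
have cntE : cnt B (orth U) = (\sum_(b in B) (b \in orth U))%N.
  rewrite /cnt -sum1_card big_mkcond [RHS]big_mkcond; apply: eq_bigr => b _.
  by rewrite inE; case: (b \in B); case: (b \in orth U).
rewrite -sum1_card !big_distrr /= cntE !big_distrr -!big_split /=.
apply: eq_bigr => b _; rewrite card_orth_vec.
by case: ifP => _; rewrite ?muln1 ?muln0 ?addn0 1?addnC.
Qed.

Lemma memv_addv_lineP U x y :
  reflect (exists2 u, u \in U & exists k, y = u + k *: x) (y \in U + <[x]>)%VS.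
Proof.
apply: (iffP memv_addP) => [[u uU [w /vlineP[k ->] ->]]|[u uU [k ->]]].
  by exists u => //; exists k.
by exists u => //; exists (k *: x) => //; rewrite memvZ ?memv_line.
Qed.

Lemma memv_addv_line_exchange U x y :
  y \notin U -> (y \in U + <[x]>)%VS -> (x \in U + <[y]>)%VS.
Proof.
move=> yU /memv_addv_lineP[u uU [k yE]]; have k0 : k != 0.
  by apply: contraNneq yU => k0; rewrite yE k0 scale0r addr0.
apply/memv_addv_lineP; exists (- k^-1 *: u); first by rewrite memvZ.
by exists k^-1; rewrite yE scalerDr scaleNr addKr scalerA mulVf ?scale1r.
Qed.

Lemma card_vspaceD M U : (M <= U)%VS ->
  (#|[set y in U | y \notin M]| + #|M| = #|U|)%N.
Proof.
move=> /subvP sMU.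
rewrite -[RHS]cardsE -[RHS](cardsID [set y in M]) addnC; congr (_ + _)%N.
  rewrite -cardsE; apply: eq_card => y; rewrite !inE andb_idl //; exact: sMU.
by apply: eq_card => y; rewrite !inE andbC.
Qed.

(** By exchange, z lies in M + <y> iff y lies in M + <z>, so each z is counted once for every vector
    of M + <z> outside M. *)
Lemma sum_cnt_pencil B M U : (M <= U)%VS ->
  (\sum_(y in U | y \notin M) #|[set z in B | (z \notin M) && (z \in M + <[y]>)%VS]| =
    #|[set z in B | (z \in U) && (z \notin M)]| * (#|F|.-1 * #|M|))%N.
Proof.
move=> sMU; under eq_bigr => y _ do rewrite -sum1_card.
rewrite (exchange_big_dep (fun z => z \in [set z in B | (z \in U) && (z \notin M)])) /=.
  rewrite -sum_nat_const; apply: eq_bigr => z; rewrite !inE => /and3P[zB zU zM].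
  rewrite sum1_card.
  have sMz : (M <= M + <[z]>)%VS by apply: addvSl.
  have := card_vspaceD sMz; rewrite !card_vspace dim_addv_line // expnS.
  have q_gt0 : (0 < #|F|)%N by apply/card_gt0P; exists 0.
  rewrite -[X in (X * #|F| ^ _)%N](prednK q_gt0) mulSn addnC => /addnI <-.
  apply: eq_card => y; rewrite unfold_in !inE zB zM /=.
  apply/andP/andP => [[/andP[yU yM] zMy]|[yMz yM]].
    by rewrite yM; split=> //; apply: memv_addv_line_exchange.
  rewrite yM andbT; split; last exact: memv_addv_line_exchange yMz.
  apply: subvP yMz; rewrite subv_add sMU; exact: zU.
move=> y z /andP[yU yM]; rewrite !inE => /and3P[-> -> zMy] /=; rewrite andbT.
by apply: subvP zMy; rewrite subv_add sMU; apply: yU.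
Qed.

End Orthogonality.

(** * Bilinearity of the defect *)

Section Polarity.

Variables (F : finFieldType) (m : nat).
Notation V := 'rV[F]_m.
Hypothesis pchar2 : 2 \in [pchar F].

Variables (c : V -> F) (nu : V).
Hypothesis cZ : forall a (x : V), c (a *: x) = a * c x.
Hypothesis c_nu : forall (x : V) t, c (x + t *: nu) = c x + t.

Definition defect (x y : V) := c (x + y) + c x + c y.

Hypothesis m_gt3 : (3 < m)%N.
Hypothesis perpP : forall x : V, x \notin <[nu]>%VS ->
  exists2 z : V, z != 0 & forall y : V, (defect x y == 0) = (dot z y == 0).

Implicit Types (x y z : V) (a t : F).

Let oppF a : - a = a. Proof. exact: oppr_pchar2. Qed.

Let addFF a : a + a = 0. Proof. exact: addrr_pchar2. Qed.

Let addVV x : x + x = 0.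
Proof. by rewrite -(scale1r x) -scalerDl addFF scale0r. Qed.

Lemma addr_eq_pchar2 a t : a + t = 0 -> a = t.
Proof. by move/eqP; rewrite addr_eq0 oppF => /eqP. Qed.

Lemma defectC x y : defect x y = defect y x.
Proof. by rewrite /defect (addrC x) addrAC. Qed.

Lemma defectZ a x y : defect (a *: x) (a *: y) = a * defect x y.
Proof. by rewrite /defect -scalerDr !cZ -!mulrDr. Qed.

Lemma c0 : c 0 = 0.
Proof. by rewrite -(scale0r 0) cZ mul0r. Qed.

Lemma defect0 x : defect x 0 = 0.
Proof. by rewrite /defect c0 !addr0. Qed.

Lemma defect_id x : defect x x = 0.
Proof. by rewrite /defect addVV c0 add0r. Qed.

Lemma defect_nu x t y : defect x (y + t *: nu) = defect x y.
Proof.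
by rewrite /defect addrA !c_nu; move: (c _) (c _) (c _) => u v w;
  rewrite -!addrA (addrCA t) (addrCA t) addFF addr0.
Qed.

Lemma defect_line_nu x y : x \in <[nu]>%VS -> defect x y = 0.
Proof.
case/vlineP => t ->; rewrite defectC -[t *: nu]add0r defect_nu.
exact: defect0.
Qed.

Lemma perpD x y z : defect x y = 0 -> defect x z = 0 -> defect x (y + z) = 0.
Proof.
have [/defect_line_nu xn _ _|/perpP[w _ wE]] := boolP (x \in <[nu]>%VS).
  exact: xn.
move=> /eqP; rewrite wE => /eqP wy /eqP; rewrite wE => /eqP wz.
by apply/eqP; rewrite wE dotDr wy wz addr0.
Qed.

Lemma perpZ x y a : defect x y = 0 -> defect x (a *: y) = 0.
Proof.
have [/defect_line_nu xn _|/perpP[w _ wE]] := boolP (x \in <[nu]>%VS).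
  exact: xn.
by move=> /eqP; rewrite wE => /eqP wy; apply/eqP; rewrite wE dotZr wy mulr0.
Qed.

Lemma perp_decomp x y z : defect x y != 0 ->
  exists a, defect x (z + a *: y) = 0.
Proof.
have [/defect_line_nu xn|/perpP[w _ wE]] := boolP (x \in <[nu]>%VS).
  by rewrite xn eqxx.
rewrite wE => wy; exists (- (dot w z / dot w y)).
by apply/eqP; rewrite wE dotDr dotZr mulNr divfK // subrr.
Qed.

Lemma c_perpD x y : defect x y = 0 -> c (x + y) = c x + c y.
Proof. by rewrite /defect -addrA => /addr_eq_pchar2. Qed.

(** c is additive on orthogonal pairs ([c_perpD]), and x + y is orthogonal to x' + y', so every term
    of the defect splits. *)
Lemma defect_perp_sum x y x' y' :
    defect x x' = 0 -> defect x y' = 0 -> defect y x' = 0 -> defect y y' = 0 ->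
  defect (x + x') (y + y') = defect x y + defect x' y'.
Proof.
move=> xx' xy' yx' yy'; rewrite /defect (addrACA x).
rewrite (c_perpD xx') (c_perpD yy').
have -> : c (x + y + (x' + y')) = c (x + y) + c (x' + y').
  by apply: c_perpD; rewrite defectC; apply: perpD; rewrite defectC; apply: perpD.
by ring.
Qed.

(* A second hyperbolic pair x', y' orthogonal to x, y with the same defect    *)
(* makes x + x' orthogonal to y + y' + s x for every s.                       *)
Lemma defect_transvection x y s : defect x (y + s *: x) = defect x y.
Proof.
have [xy0|xy] := eqVneq (defect x y) 0.
  by rewrite xy0; apply: perpD => //; apply: perpZ (defect_id x).
have xn : x \notin <[nu]>%VS by apply: contraNN xy => /defect_line_nu->.
have yn : y \notin <[nu]>%VS.
  by apply: contraNN xy => /defect_line_nu yn; rewrite defectC yn.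
have [zx zx0 zxE] := perpP xn; have [zy zy0 zyE] := perpP yn.
pose U := (<[zx]> + <[zy]>)%VS.
have dimU : (m <= \dim (orth U) + 2)%N.
  have leU : (\dim U <= 2)%N.
    rewrite /U; apply: leq_trans (dimv_add_leqif _ _).1 _.
    by rewrite !dim_vline zx0 zy0.
  by rewrite dim_orth; move: (\dim U) leU => d; lia.
(* As m > 3, [orth U] has dimension at least 2 and cannot lie in <nu>. *)
have [x' Ux' x'n] : exists2 x', x' \in orth U & x' \notin <[nu]>%VS.
  apply/subvPn; apply/negP => /dimvS; rewrite dim_vline.
  by move: (\dim _) dimU m_gt3 => d; case: (nu != 0); lia.
have perpU w : w \in orth U -> defect x w = 0 /\ defect y w = 0.
  rewrite orthD memv_cap !orth_lineE !(dotC w) => /andP[wx wy].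
  by split; apply/eqP; rewrite ?zxE ?zyE.
have [xx' yx'] := perpU _ Ux'.
have [z' z'0 z'E] := perpP x'n.
(* Otherwise z' would be a combination of zx and zy. Evaluating it at x and at y, both orthogonal to
   x', kills its coefficients because D(x, y) is nonzero. *)
have [y' Uy' x'y'] : exists2 y', y' \in orth U & y' \notin orth <[z']>%VS.
  apply/subvPn; rewrite orthSE; apply/negP => /subvP/(_ _ (memv_line _)).
  case/memv_addP => _ /vlineP[a ->] [_ /vlineP[b ->] zE].
  have := z'E x; rewrite defectC xx' eqxx zE dotDl !dotZl.
  have -> : dot zx x = 0 by apply/eqP; rewrite -zxE defect_id.
  rewrite mulr0 add0r => /esym; rewrite mulf_eq0 -zyE defectC (negPf xy) orbF.
  move=> /eqP b0; have := z'E y; rewrite defectC yx' eqxx zE dotDl !dotZl b0.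
  rewrite mul0r addr0 => /esym; rewrite mulf_eq0 -zxE (negPf xy) orbF => /eqP a0.
  by move: z'0; rewrite zE a0 b0 !scale0r addr0 eqxx.
rewrite orth_lineE dotC -z'E in x'y'.
have [xy' yy'] := perpU _ Uy'.
have xx'y' : defect (x + x') y' != 0.
  have := defect_perp_sum xx' xy' (etrans (defectC _ _) (defect0 _))
    (etrans (defectC _ _) (defect0 _)).
  by rewrite add0r defect0 add0r => ->.
have [a yP] := perp_decomp y xx'y'.
have xx'x : defect (x + x') x = 0.
  have := defect_perp_sum xx' (defect0 x) xx' (defect0 x).
  by rewrite addr0 defect_id defect0 addr0.
have eq_defect w : defect x' w = 0 -> defect y' w = 0 ->
    defect (x + x') (w + a *: y') = 0 -> defect x w = defect x' (a *: y').
  move=> x'w y'w; rewrite defect_perp_sum //; last 3 first.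
  - exact: perpZ.
  - by rewrite defectC.
  - by apply: perpZ; rewrite defectC.
  exact: addr_eq_pchar2.
have x'y : defect x' y = 0 by rewrite defectC.
have y'y : defect y' y = 0 by rewrite defectC.
rewrite (eq_defect y) // eq_defect //.
- by apply: perpD => //; apply: perpZ; rewrite defectC.
- by apply: perpD => //; apply: perpZ; rewrite defectC.
by rewrite addrAC; apply: perpD => //; apply: perpZ.
Qed.

Lemma defect_transvectionl x y s : defect (x + s *: y) y = defect x y.
Proof. by rewrite defectC defect_transvection defectC. Qed.

(** diag(a, 1/a) has determinant 1, hence is a product of transvections of the plane on x and y; x1
    and y1 are intermediate images. *)
Lemma defect_diag x y a : a != 0 -> defect (a *: x) (a^-1 *: y) = defect x y.
Proof.
move=> a0; pose x1 := x + (- (a - 1) / a) *: y; pose y1 := y + 1 *: x1.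
have -> : a *: x = x1 + (a - 1) *: y1.
  by apply/rowP => i; rewrite !mxE; field.
rewrite -(defect_transvection _ _ a).
have -> : a^-1 *: y + a *: (x1 + (a - 1) *: y1) = y1 + (a - a^-1) *: (x1 + (a - 1) *: y1).
  by apply/rowP => i; rewrite !mxE; field.
by rewrite defect_transvection defect_transvectionl defect_transvection defect_transvectionl.
Qed.

Lemma sqr_onto a : exists b, a = b ^+ 2.
Proof.
have inj : injective (fun b : F => b ^+ 2).
  by move=> b d /eqP; rewrite eqf_sqr oppF orbb => /eqP.
by have [g _ gK] := injF_bij inj; exists (g a); rewrite gK.
Qed.

(** Scaling both arguments by a multiplies D by a, and [defect_diag] moves a factor a from the first
    argument to the second. *)
Lemma defectZr x y a : defect x (a ^+ 2 *: y) = a * defect x y.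
Proof.
have [->|a0] := eqVneq a 0; first by rewrite expr0n scale0r defect0 mul0r.
rewrite -defectZ -[LHS](defect_diag _ _ a0) scalerA.
by congr (defect _ (_ *: _)); field.
Qed.

(** A multiple of x added to z makes z orthogonal to y too. The orthogonal splitting then drops z,
    and [defect_transvection] absorbs the multiple of x. *)
Lemma defect_shift x y z : defect x z = 0 -> defect x (y + z) = defect x y.
Proof.
move=> xz; have [xy0|xy] := eqVneq (defect x y) 0.
  by rewrite xy0; apply: perpD.
have [s yP] : exists s, defect y (z + s *: x) = 0.
  by apply: perp_decomp; rewrite defectC.
have xzs : defect x (z + s *: x) = 0.
  by apply: perpD => //; apply: perpZ (defect_id x).
rewrite -(defect_transvection x (y + z) s) -addrA.
have := defect_perp_sum (defect0 x) xzs (defect0 y) yP.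
by rewrite addr0 (defectC 0) defect0 addr0.
Qed.

(** Modulo vectors orthogonal to x, z is s y. With s = t^2, additivity comes down to 1 + s = (1 +
    t)^2. *)
Lemma defectDr x y z : defect x (y + z) = defect x y + defect x z.
Proof.
have [xy0|xy] := eqVneq (defect x y) 0.
  by rewrite addrC defect_shift // xy0 add0r.
have [s zP] := perp_decomp z xy; have [t sE] := sqr_onto s.
have zE : z = s *: y + (z + s *: y).
  by rewrite addrCA -scalerDl addFF scale0r addr0.
rewrite {1}zE addrA -{1}[y]scale1r -scalerDl defect_shift //.
have -> : defect x z = t * defect x y.
  by rewrite {1}zE defect_shift // sE defectZr.
have -> : 1 + s = (1 + t) ^+ 2 by rewrite sqrrD expr1n mul1r mulr2n addFF addr0 sE.
by rewrite defectZr mulrDl mul1r.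
Qed.

End Polarity.

(** * Moments of hyperplane intersection sizes and the resulting equations *)

Section Moments.

Variables (F : finFieldType) (n : nat).
Notation V := 'rV[F]_n.
Implicit Types (x y z f : V) (M U W : {vspace V}) (B : {set V}).

Lemma cntE B U : cnt B U = (\sum_(b in B) (b \in U))%N.
Proof.
rewrite /cnt -sum1_card big_mkcond [RHS]big_mkcond; apply: eq_bigr => b _.
by rewrite inE; case: (b \in B); case: (b \in U).
Qed.

Lemma sum_cnt_orth_disjoint B M : cnt B M = 0 ->
  (#|F| * (\sum_(f in orth M) cnt B (orth <[f]>)) = #|orth M| * #|B|)%N.
Proof.
by move=> BM; have := sum_cnt_orth B (orth M); rewrite orthK BM !muln0 !addn0.
Qed.

(** Expanding one factor of the square over y in B leaves first moments over the hyperplanes on M +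
    <y>, a subspace that meets B in K vectors; u is the size of its [orth]. *)
Lemma sum_cnt_orth_sq B M K :
    {in B, forall y, y \notin M /\ cnt B (M + <[y]>) = K} ->
  let u := (#|F| ^ (n - (\dim M).+1))%N in
  (#|F| * (\sum_(f in orth M) cnt B (orth <[f]>) ^ 2) + #|B| * (u * K) =
    #|B| * (u * #|B| + #|F| * u * K))%N.
Proof.
move=> BK u.
have -> : (\sum_(f in orth M) cnt B (orth <[f]>) ^ 2 =
    \sum_(y in B) \sum_(f in orth (M + <[y]>)) cnt B (orth <[f]>))%N.
  under eq_bigr => f _ do rewrite expnS expn1 [X in (X * _)%N]cntE big_distrl /=.
  rewrite exchange_big; apply: eq_bigr => y yB; rewrite big_mkcond [RHS]big_mkcond.
  apply: eq_bigr => f _; rewrite orthD memv_cap (orth_lineE y f) (orth_lineE f y) dotC.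
  by case: ifP => //= _; case: eqP => _; rewrite ?mul1n ?mul0n.
rewrite big_distrr -sum_nat_const -big_split -sum_nat_const /=.
apply: eq_bigr => y yB; have [yM yK] := BK y yB.
have := sum_cnt_orth B (orth (M + <[y]>)); rewrite orthK yK.
by rewrite card_vspace dim_orth dim_addv_line.
Qed.

(** A value g in {0, a, b} satisfies g^2 - (a + b) g + a b = a b [g = 0]. This is summed over f <>
    0, with negative terms moved across. *)
Lemma sum_three_valued U (g : V -> nat) (a b : nat) :
    {in U, forall f, f != 0 -> g f \in [:: 0; a; b]} ->
  (\sum_(f in U) g f ^ 2 + a * b * (#|U| - 1) + (a + b) * g 0%R =
   (a + b) * (\sum_(f in U) g f) + g 0%R ^ 2
     + a * b * #|[set f in U | (f != 0%R) && (g f == 0%N)]|)%N.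
Proof.
move=> gU; have U0 := mem0v U.
have -> : (#|U| - 1 = \sum_(f in U | f != 0%R) 1)%N.
  by rewrite -sum1_card (bigD1 0) //= addKn.
have -> : #|[set f in U | (f != 0%R) && (g f == 0)]| = (\sum_(f in U | f != 0%R) (g f == 0%N))%N.
  rewrite -sum1_card big_mkcond [RHS]big_mkcond; apply: eq_bigr => f _.
  by rewrite inE; case: (f \in U); case: (f != 0%R); case: (g f == 0%N).
have D1 (G : V -> nat) : (\sum_(f in U) G f = G 0%R + \sum_(f in U | f != 0%R) G f)%N.
  by rewrite (bigD1 0).
rewrite !D1.
suff : (\sum_(f in U | f != 0%R) g f ^ 2 + a * b * (\sum_(f in U | f != 0%R) 1)
    = (a + b) * (\sum_(f in U | f != 0%R) g f)
     + a * b * (\sum_(f in U | f != 0%R) (g f == 0)))%N by lia.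
rewrite !big_distrr -!big_split /=; apply: eq_bigr => f /andP[fU f0].
have := gU f fU f0; rewrite !inE.
by case/or3P => /eqP ->; case: eqP => /=; nia.
Qed.

End Moments.

(** b stands for #|full P|, and S1, S2 for its moments over the hyperplanes on P. Eliminating them
    leaves a quadratic in b = q k R with roots R = q + 1 and R = q^2 + 1. *)
Lemma full_count_solve (k b S1 S2 : nat) : (0 < k)%N -> let q := k.+1 in
  (q * S1 = q ^ 4 * b)%N ->
  (S2 + q * k * (q * k * (q + 1)) * (q ^ 4 - 1) + (q * k + q * k * (q + 1)) * b =
    (q * k + q * k * (q + 1)) * S1 + b ^ 2)%N ->
  (q * S2 + b * (q ^ 3 * (q * k)) = b * (q ^ 3 * b + q * q ^ 3 * (q * k)))%N ->
  b = (q * k * (q + 1))%N \/ b = (q * k * (q ^ 2 + 1))%N.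
Proof.
move=> k_gt0 q E1 E2 E3.
have F1 : S1 = (q ^ 3 * b)%N by apply/eqP; rewrite -(@eqn_pmul2l q) // E1 mulnA.
have F3 : (S2 + b * (q ^ 3 * k) = b * (q ^ 2 * b + q ^ 4 * k))%N.
  by apply/eqP; rewrite -(@eqn_pmul2l q) // mulnDr; apply/eqP; move: E3; rewrite /q; lia.
have q4 : (q ^ 4 - 1 = k * (q + 1) * (q ^ 2 + 1))%N.
  by apply/eqP; rewrite -(eqn_add2r 1) subnK ?expn_gt0 //; apply/eqP; rewrite /q; lia.
rewrite q4 F1 in E2.
have : (k * (q + 1))%:Z
    * ((b%:Z - (q * k * (q + 1))%:Z) * (b%:Z - (q * k * (q ^ 2 + 1))%:Z)) = 0.
  by move: E2 F3; rewrite /q; lia.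
move/eqP; rewrite !mulf_eq0 !subr_eq0 !eqz_nat.
by case/orP => [|/orP[]/eqP->]; [rewrite muln_eq0 addn1 orbF gtn_eqF | left | right].
Qed.

Lemma square_sum_solve (k N S : nat) :
  (k.+1 * S + N * (k.+1 ^ 4 * k) = N * (k.+1 ^ 4 * N + k.+1 * k.+1 ^ 4 * k))%N ->
  S = (N * (k.+1 ^ 3 * N + k.+1 ^ 3 * k * k))%N.
Proof. by move=> E; apply/eqP; rewrite -(@eqn_pmul2l k.+1) //; apply/eqP; lia. Qed.

(** The moments of A over all hyperplanes: N is #|A|, T counts the normals of hyperplanes missing A,
    and w k.+1, w k are the nonzero intersection sizes. After elimination the equation is linear in
    T. *)
Lemma zero_count_solve (k w d N S1 S2 T r : nat) :
  (0 < k)%N -> (2 * w = k * k.+1 * k.+1)%N -> N = (w * (k * (k.+1 + d)))%N ->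
  (k.+1 * S1 = k.+1 ^ 5 * N)%N ->
  (k.+1 * S2 + N * (k.+1 ^ 4 * k) = N * (k.+1 ^ 4 * N + k.+1 * k.+1 ^ 4 * k))%N ->
  (S2 + w * k.+1 * (w * k) * (k.+1 ^ 5 - 1) + (w * k.+1 + w * k) * N =
    (w * k.+1 + w * k) * S1 + N ^ 2 + w * k.+1 * (w * k) * T)%N ->
  d = 0%N /\ r = (k * (k.+1 + 2))%N \/ d = 1%N /\ r = k ->
  T = r.
Proof.
move=> k_gt0 wE NE E1 E2 E3 dr.
have w_gt0 : (0 < w)%N by move: wE k_gt0; case: (w) => //; case: (k).
have F1 : S1 = (k.+1 ^ 4 * N)%N by apply/eqP; rewrite -(@eqn_pmul2l k.+1) // E1 mulnA.
have k2 : (k.+1 ^ 3 * k * k = w * (2 * k.+1 * k))%N.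
  rewrite (_ : w * _ = 2 * w * k.+1 * k)%N; last by rewrite !mulnA (mulnC w).
  by rewrite wE; ring.
have F2 := square_sum_solve E2; rewrite k2 in F2.
move: E3; rewrite F1 F2 NE {F1 F2 E1 E2 S1 S2 k2 NE N wE}.
have [X XE] : exists X, (k.+1 ^ 5 = X + 1)%N by exists (k.+1 ^ 5 - 1)%N; rewrite subnK ?expn_gt0.
rewrite {1}XE addnK => E3.
have {}E3 : (w ^ 2 * k * ((k.+1 + d) * (k.+1 ^ 3 * (k * (k.+1 + d)) + 2 * k.+1 * k)
      + k.+1 * X + (k.+1 + k) * (k.+1 + d)) =
    w ^ 2 * k * ((k.+1 + k) * (k.+1 ^ 4 * (k.+1 + d)) + k * (k.+1 + d) ^ 2 + k.+1 * T))%N.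
  move: E3; move: (k.+1) => q E3.
  by apply: etrans (etrans _ E3) _; ring.
move/eqP: E3; rewrite eqn_pmul2l ?muln_gt0 ?expn_gt0 ?w_gt0 // => /eqP E3.
apply/eqP; rewrite -(@eqn_pmul2l k.+1) //; apply/eqP.
by case: dr => [[d0 ->]|[d1 ->]]; subst d; move: E3 XE; lia.
Qed.

(** * Sets of vectors with the dual intersection numbers *)

Section TwoIntersection.

Variables (F : finFieldType) (e : nat).
(* Projective points are counted by their q1 = q - 1 nonzero vectors: big and *)
(* small are q - 1 times q^3 / 2 and (q^3 - q^2) / 2.                          *)
Notation V := 'rV[F]_5.
Notation h := e.+1.
Notation q := (2 * e).+2.
Notation q1 := (2 * e).+1.
Notation w := (q1 * h * q)%N.
Notation big := (w * q)%N.
Notation small := (w * q1)%N.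
Hypothesis card_F : #|F| = q.
Hypothesis e_gt0 : (0 < e)%N.

Variable A : {set V}.
Hypothesis A0 : 0 \notin A.
Hypothesis AZ : forall (a : F) (x : V), a != 0 -> x \in A -> a *: x \in A.
Hypothesis A_neq0 : A != set0.

Hypothesis A_hyperplane : forall f : V, f != 0 ->
  cnt A (orth <[f]>) \in [:: 0; big; small].
Hypothesis A_line : forall L : {vspace V}, \dim L = 2%N ->
  cnt A L \in [:: 0; q1 * h; q1 * q]%N.

Implicit Types (x y z f P : V) (U L : {vspace V}).

(** * Lines through a point of A *)

Lemma dim_line2 x y : x != 0 -> y \notin <[x]>%VS -> \dim (<[x]> + <[y]>) = 2%N.
Proof. by move=> x0 yx; rewrite dim_addv_line // dim_vline x0. Qed.

Lemma A_neq P : P \in A -> P != 0.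
Proof. by apply: contraTneq => ->. Qed.

Lemma cnt_vline P : P \in A -> cnt A <[P]> = q1.
Proof.
move=> PA; have P0 := A_neq PA.
have := @card_vspaceD F 5 0 <[P]> (sub0v _); rewrite !card_vspace dimv0 dim_vline P0.
rewrite expn0 expn1 card_F => cardE.
suff -> : cnt A <[P]> = #|[set y in <[P]>%VS | y \notin 0%VS]| by move: #|_| cardE => c; lia.
apply: eq_card => y; rewrite !inE memv0.
apply/andP/andP => [[yA yP]|[/vlineP[a ->]]]; first by split=> //; apply: A_neq.
rewrite scaler_eq0 negb_or => /andP[a0 _]; split; first exact: AZ.
by rewrite memvZ ?memv_line.
Qed.

(** Lines are counted through their vectors: each of the R lines contributes its q (q - 1) vectors
    outside <P>. *)
Definition full P := [set y | (y \notin <[P]>%VS) && (cnt A (<[P]> + <[y]>) == q1 * q)%N].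

Lemma cntD_vline P U : P \in A -> P \in U ->
  cnt A U = (#|[set z in A | (z \in U) && (z \notin <[P]>%VS)]| + q1)%N.
Proof.
move=> PA PU; rewrite -(cnt_vline PA) /cnt -(cardsID [set z in <[P]>%VS]) addnC.
congr (_ + _)%N; apply: eq_card => z; rewrite !inE.
  by case: (z \in A); case: (z \in U); case: (z \in _).
case zP : (z \in <[P]>%VS); rewrite ?andbF ?andbT //.
by case/vlineP: zP => a ->; rewrite memvZ // andbT.
Qed.

(** As P is in A, the line has q/2 or q points of A; besides P these are e = q/2 - 1 or e + h = q -
    1. *)
Lemma cnt_full_line P y : P \in A -> y \notin <[P]>%VS ->
  #|[set z in A | (z \notin <[P]>%VS) && (z \in <[P]> + <[y]>)%VS]| =
    (q1 * e + (y \in full P) * (q1 * h))%N.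
Proof.
move=> PA yP; have P0 := A_neq PA.
have PPy : P \in (<[P]> + <[y]>)%VS by rewrite memvE addvSl.
have := A_line (dim_line2 P0 yP); rewrite !inE yP /=.
have := cntD_vline PA PPy.
rewrite (eq_card (B := [set z in A | (z \notin <[P]>%VS) && (z \in <[P]> + <[y]>)%VS])); last first.
  by move=> z; rewrite !inE [(z \in (_ + _)%VS) && _]andbC.
move=> -> cntE; move: #|_| cntE => c cntE.
have ne : (q1 * h == q1 * q)%N = false by rewrite eqn_pmul2l //; lia.
by case/or3P: cntE => /eqP cE; rewrite cE ?ne ?eqxx /=; lia.
Qed.

(** Sum of [cnt_full_line] over the lines of U on P: the sizes of A and of [full P] in U determine
    each other. *)
Lemma cnt_full P U : P \in A -> P \in U ->
  (e * #|U| + h * cnt (full P) U + q1 * q = cnt A U * q + e * q)%N.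
Proof.
move=> PA PU; have P0 := A_neq PA.
have sPU : (<[P]> <= U)%VS by rewrite -memvE.
have := sum_cnt_pencil A sPU; have := card_vspaceD sPU.
rewrite card_vspace dim_vline P0 expn1 card_F => cardU.
under eq_bigr => y /andP[yU yP] do rewrite cnt_full_line //.
rewrite big_split /= sum_nat_const -big_distrl /=.
have -> : (\sum_(y in U | y \notin <[P]>%VS) (y \in full P) = cnt (full P) U)%N.
  rewrite /cnt -sum1_card big_mkcond [RHS]big_mkcond; apply: eq_bigr => y _.
  rewrite !inE; case: (y \in U); case: (y \notin _) => //=; rewrite ?andbF //.
  by case: (_ == _).
have -> : #|[pred y in U | y \notin <[P]>%VS]| = #|[set y in U | y \notin <[P]>%VS]|.
  by apply: eq_card => y; rewrite !inE.
rewrite (cntD_vline PA PU) -cardU.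
move: #|[set y in U | _]| #|[set z in A | _]| (cnt (full P) U) => Y c1 cf.
move=> E; suff : (q1 * (e * Y + h * cf) = q1 * (c1 * q))%N.
  by move/eqP; rewrite eqn_pmul2l // => /eqP; lia.
by move: E; lia.
Qed.

Lemma card_orth_line f : f != 0 -> #|orth <[f]>%VS| = (q ^ 4)%N.
Proof. by move=> f0; rewrite card_vspace card_F dim_orth dim_vline f0. Qed.

Lemma cnt_full_hyperplane P f : P \in A -> f != 0 -> P \in orth <[f]>%VS ->
  cnt A (orth <[f]>) = big /\ cnt (full P) (orth <[f]>) = (q * q1 * (q + 1))%N
  \/ cnt A (orth <[f]>) = small /\ cnt (full P) (orth <[f]>) = (q * q1)%N.
Proof.
move=> PA f0 Pf; have := cnt_full PA Pf; rewrite card_orth_line //.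
have : (0 < cnt A (orth <[f]>))%N by apply/card_gt0P; exists P; rewrite inE PA.
have := A_hyperplane f0; rewrite !inE.
move: (cnt A _) (cnt (full P) _) => c r /or3P[]/eqP -> // _ E; [left|right].
  split=> //; apply/eqP; rewrite -(@eqn_pmul2l h) //; apply/eqP; move: E; lia.
split=> //; apply/eqP; rewrite -(@eqn_pmul2l h) //; apply/eqP; move: E; lia.
Qed.

Lemma full_shift P y z : y \in full P -> z \notin <[P]>%VS ->
  (z \in <[P]> + <[y]>)%VS -> z \in full P.
Proof.
rewrite !inE => /andP[yP yfull] zP zPy; rewrite zP /=.
suff -> : (<[P]> + <[z]> = <[P]> + <[y]>)%VS by [].
have yPz := memv_addv_line_exchange zP zPy.
by apply: subv_anti; rewrite !subv_add !addvSl -!memvE zPy.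
Qed.

Lemma cnt_full_vline P : cnt (full P) <[P]> = 0%N.
Proof. by apply: eq_card0 => y; rewrite !inE; case: (y \in <[P]>%VS); rewrite ?andbF. Qed.

Lemma cnt_full_addv P y : P \in A -> y \in full P ->
  cnt (full P) (<[P]> + <[y]>) = (q * q1)%N.
Proof.
move=> PA yP; have P0 := A_neq PA.
have yP' : y \notin <[P]>%VS by move: yP; rewrite inE => /andP[].
have := card_vspaceD (addvSl <[P]> <[y]>).
rewrite !card_vspace dim_line2 // dim_vline P0 card_F expn1.
have -> : cnt (full P) (<[P]> + <[y]>) = #|[set z in (<[P]> + <[y]>)%VS | z \notin <[P]>%VS]|.
  apply: eq_card => z; rewrite [LHS]inE [RHS]inE andbC.
  case zPy: (z \in (_ + _)%VS) => //=; apply/idP/idP => [|zP].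
    by rewrite inE => /andP[].
  exact: full_shift yP zP zPy.
by move: #|_| => c; lia.
Qed.

Lemma cnt_fullv (B : {set V}) : cnt B fullv = #|B|.
Proof. by apply: eq_card => y; rewrite inE memvf andbT. Qed.

Lemma orth_line0 : orth <[0 : V]>%VS = fullv.
Proof. by apply/vspaceP => x; rewrite orth_lineE dot0r eqxx memvf. Qed.

Lemma cnt_orth0 (B : {set V}) : cnt B (orth <[0 : V]>) = #|B|.
Proof. by rewrite orth_line0 cnt_fullv. Qed.

(** Hyperplanes on P contain q + 1 full lines or one. None contains zero, so the last term of
    [sum_three_valued] vanishes and the two moments give a quadratic for the size. *)
Lemma card_full P : P \in A ->
  #|full P| = (q * q1 * (q + 1))%N \/ #|full P| = (q * q1 * (q ^ 2 + 1))%N.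
Proof.
move=> PA; have P0 := A_neq PA.
have S1 := sum_cnt_orth_disjoint (cnt_full_vline P).
have fullP : {in full P, forall y, y \notin <[P]>%VS /\ cnt (full P) (<[P]> + <[y]>) = (q * q1)%N}.
  by move=> y yP; split; [move: yP; rewrite inE => /andP[] | apply: cnt_full_addv].
have := sum_cnt_orth_sq fullP => /=; rewrite dim_vline P0.
have vals : {in orth <[P]>%VS, forall f, f != 0 ->
    cnt (full P) (orth <[f]>) \in [:: 0; q * q1; q * q1 * (q + 1)]%N}.
  move=> f; rewrite orth_lineE dotC -orth_lineE => fP f0; rewrite !inE.
  by case: (cnt_full_hyperplane PA f0 fP) => [[_ ->]|[_ ->]]; rewrite eqxx !orbT.
have := sum_three_valued vals.
have -> : #|[set f in orth <[P]>%VS | (f != 0) && (cnt (full P) (orth <[f]>) == 0%N)]| = 0%N.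
  apply: eq_card0 => f; rewrite !inE; apply/negP => /and3P[fP f0].
  move: fP; rewrite orth_lineE dotC -orth_lineE => fP.
  by case: (cnt_full_hyperplane PA f0 fP) => [[_ ->]|[_ ->]].
rewrite cnt_orth0 card_orth_line // in S1 *; rewrite card_F in S1 *.
rewrite muln0 addn0 => E2 E3.
exact: (@full_count_solve q1 _ _ _ _ S1 E2 E3).
Qed.

(** * The size of A and the hyperplanes missing A *)

Definition zeros := [set f : V | (f != 0) && (cnt A (orth <[f]>) == 0%N)].

Lemma card_A d P : P \in A -> #|full P| = (q * q1 * (q ^ d.+1 + 1))%N -> (d < 2)%N ->
  #|A| = (w * (q1 * (q + d)))%N.
Proof.
move=> PA fullE d_lt2; have := cnt_full PA (memvf P).
rewrite !cnt_fullv card_vspace dimvf /dim /= card_F fullE => E.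
apply/eqP; rewrite -(@eqn_pmul2r q) //; apply/eqP; clear fullE; move: #|A| E => c.
by case: d d_lt2 => [|[]] // _; lia.
Qed.

Lemma cnt0v : cnt A 0 = 0%N.
Proof.
apply: eq_card0 => x; rewrite !inE memv0; apply/negP => /andP[xA /eqP x0].
by move: A0; rewrite -x0 xA.
Qed.

Lemma card_zeros d r : #|A| = (w * (q1 * (q + d)))%N ->
  d = 0%N /\ r = (q1 * (q + 2))%N \/ d = 1%N /\ r = q1 -> #|zeros| = r.
Proof.
move=> AE.
have S1 := sum_cnt_orth_disjoint cnt0v.
have A_vline : {in A, forall y, y \notin 0%VS /\ cnt A (0 + <[y]>) = q1}.
  by move=> y yA; rewrite memv0 A_neq // add0v cnt_vline.
have := sum_cnt_orth_sq A_vline => /=; rewrite dimv0.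
have vals : {in orth (0%VS : {vspace V}), forall f, f != 0 ->
    cnt A (orth <[f]>) \in [:: 0; big; small]%N} by move=> f _; apply: A_hyperplane.
have := sum_three_valued vals.
have -> : #|[set f in orth 0%VS | (f != 0) && (cnt A (orth <[f]>) == 0%N)]| = #|zeros|.
  by apply: eq_card => f; rewrite !inE orth0 memvf.
rewrite card_F cnt_orth0 in S1 *; rewrite [#|orth 0%VS|]card_vspace orth0 dimvf /dim /= card_F in S1 *.
move=> E3 E2; apply: (zero_count_solve _ _ AE S1 E2 E3) => //.
by clear; lia.
Qed.

Lemma exists_A : exists P, P \in A.
Proof. exact/set0Pn. Qed.

Lemma card_vspace_q U : #|U| = (q ^ \dim U)%N.
Proof. by rewrite card_vspace card_F. Qed.

(** Two full lines span pi. A hyperplane on pi contains more than one full line on P, hence all q +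
    1; so all of them lie in pi, the intersection of these hyperplanes. *)
Lemma full_plane P : P \in A -> #|full P| = (q * q1 * (q + 1))%N ->
  exists2 pi, \dim pi = 3%N & [/\ P \in pi, {subset full P <= pi} & cnt A pi = (q1 * q ^ 2)%N].
Proof.
move=> PA cardE; have P0 := A_neq PA.
have [y yP] : exists y, y \in full P by apply/card_gt0P; rewrite cardE.
have yP' : y \notin <[P]>%VS by move: yP; rewrite inE => /andP[].
have [z zP zPy] : exists2 z, z \in full P & z \notin (<[P]> + <[y]>)%VS.
  have lt : (cnt (full P) (<[P]> + <[y]>) < #|full P|)%N.
    by rewrite (cnt_full_addv PA yP) cardE; lia.
  apply/exists_inP; apply: contraTT lt => /exists_inPn all_in; rewrite -leqNgt.
  apply: subset_leq_card; apply/subsetP => z zP; rewrite inE zP /=.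
  by have := all_in z zP; rewrite negbK.
pose pi := (<[P]> + <[y]> + <[z]>)%VS.
have dpi : \dim pi = 3%N by rewrite dim_addv_line // dim_line2.
have Ppi : P \in pi by rewrite memvE /pi -addvA addvSl.
have sPypi : (<[P]> + <[y]> <= pi)%VS by apply: addvSl.
have fullpi : {subset full P <= pi}.
  move=> x xP; rewrite -[pi]orthK; apply/orthP => f fpi; rewrite dotC.
  have [->|f0] := eqVneq f 0; first exact: dot0l.
  have inpi u : u \in pi -> u \in orth <[f]>%VS.
    by move=> upi; rewrite orth_lineE dotC (orthP _ _ fpi).
  have gt : (q * q1 < cnt (full P) (orth <[f]>))%N.
    rewrite -(cnt_full_addv PA yP); apply: proper_card.
    apply/properP; split.
      apply/subsetP => u; rewrite !inE => /andP[-> uPy] /=.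
      by rewrite inpi //; apply: subvP sPypi _ uPy.
    exists z; last by rewrite inE negb_and zPy orbT.
    rewrite inE zP inpi // memvE; exact: addvSr.
  have [[_ fE]|[_ fE]] := cnt_full_hyperplane PA f0 (inpi _ Ppi);
    last by rewrite fE ltnn in gt.
  have sub : [set u in full P | u \in orth <[f]>%VS] \subset full P.
    by apply/subsetP => u; rewrite inE => /andP[].
  have /eqP eqfull : [set u in full P | u \in orth <[f]>%VS] == full P.
    by rewrite eqEcard sub cardE -fE leqnn.
  by move: xP; rewrite -eqfull inE orth_lineE dotC => /andP[_ /eqP].
exists pi => //; split=> //.
have := cnt_full PA Ppi.
have -> : cnt (full P) pi = #|full P|.
  by apply: eq_card => u; rewrite [LHS]inE andb_idr // => /fullpi.
rewrite cardE card_vspace_q dpi; move: (cnt A pi) => c E.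
by apply/eqP; rewrite -(@eqn_pmul2r q) //; apply/eqP; move: E; clear; lia.
Qed.

Lemma mem_zeros f x : f \in zeros -> x \in A -> dot x f != 0.
Proof.
rewrite inE => /andP[_ /eqP cnt0] xA; apply/negP => xf.
have : (0 < cnt A (orth <[f]>))%N by apply/card_gt0P; exists x; rewrite inE xA orth_lineE.
by rewrite cnt0.
Qed.

(** Only q + 1 points of pi are outside A, and the hyperplane of f cuts pi in a line of such points,
    hence in exactly these. *)
Lemma plane_zeros pi f : \dim pi = 3%N -> cnt A pi = (q1 * q ^ 2)%N -> f \in zeros ->
  \dim (pi :&: orth <[f]>) = 2%N /\ {in pi, forall x, (x \in A) = (dot x f != 0)}.
Proof.
move=> dpi cpi fZ.
have [P PA Ppi] : exists2 P, P \in A & P \in pi.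
  have : (0 < cnt A pi)%N by rewrite cpi.
  by case/card_gt0P => P; rewrite inE => /andP[]; exists P.
have fpi : f \notin orth pi.
  by apply/negP => /orthP/(_ P Ppi); rewrite dotC; apply/eqP; apply: mem_zeros.
have dl : \dim (pi :&: orth <[f]>) = 2%N.
  by rewrite -[pi in LHS]orthK -orthD dim_orth dim_addv_line // dim_orth dpi.
split=> // x xpi; apply/idP/idP; first exact: mem_zeros.
move=> xf; suff : x \in [set z in A | z \in pi] by rewrite inE => /andP[].
have sub : [set z in A | z \in pi] \subset [set z in pi | z \notin (pi :&: orth <[f]>)%VS].
  apply/subsetP => z; rewrite !inE => /andP[zA zpi]; rewrite zpi /=.
  by rewrite memv_cap orth_lineE zpi (mem_zeros fZ zA).
have /eqP -> : [set z in A | z \in pi] == [set z in pi | z \notin (pi :&: orth <[f]>)%VS].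
  rewrite eqEcard sub [#|[set z in A | _]|]cpi.
  have := card_vspaceD (capvSl pi (orth <[f]>)); rewrite !card_vspace_q dpi dl.
  by move: #|_| => c; clear; lia.
by rewrite inE memv_cap orth_lineE xpi.
Qed.

(** * Counting points through their nonzero vectors *)

Lemma vline_scale (a : F) (f : V) : a != 0 -> <[a *: f]>%VS = <[f]>%VS.
Proof.
move=> a0; apply: subv_anti; rewrite -!memvE memvZ ?memv_line //=.
by rewrite -[X in X \in _](scalerK a0) memvZ ?memv_line.
Qed.

Definition punctured (f : V) := [set y in <[f]>%VS | y \notin 0%VS].

Lemma card_punctured f : f != 0 -> #|punctured f| = q1.
Proof.
move=> f0; have := card_vspaceD (sub0v <[f]>%VS).
rewrite !card_vspace_q dimv0 dim_vline f0 expn0 expn1 /punctured.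
by move: #|_| => c; clear; lia.
Qed.

Lemma punctured_disjoint f g : g \notin <[f]>%VS -> [disjoint punctured f & punctured g].
Proof.
move=> gf; apply/pred0P => y /=; apply/negP; rewrite !inE memv0.
case/andP=> /andP[yf y0] /andP[/vlineP[a yE] _].
have a0 : a != 0 by apply: contraNneq y0 => a0; rewrite yE a0 scale0r.
by move: gf; rewrite -(scalerK a0 g) -yE memvZ.
Qed.

Lemma punctured_sub (X : {set V}) f :
  (forall (a : F) f, a != 0 -> f \in X -> a *: f \in X) -> f \in X -> punctured f \subset X.
Proof.
move=> XZ fX; apply/subsetP => y; rewrite !inE memv0 => /andP[/vlineP[a ->] af].
by apply: XZ => //; apply: contraNneq af => ->; rewrite scale0r.
Qed.

Lemma card_two_lines (X : {set V}) f1 f2 :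
    f1 \in X -> f2 \in X -> f1 != 0 -> f2 != 0 -> f2 \notin <[f1]>%VS ->
    (forall (a : F) f, a != 0 -> f \in X -> a *: f \in X) ->
  (2 * q1 <= #|X|)%N.
Proof.
move=> X1 X2 n1 n2 f21 XZ.
have sub : punctured f1 :|: punctured f2 \subset X by rewrite subUset !punctured_sub.
apply: leq_trans (subset_leq_card sub); rewrite cardsU.
by rewrite (disjoint_setI0 (punctured_disjoint f21)) cards0 !card_punctured // mulSn mul1n subn0.
Qed.

Lemma card_three_lines (X : {set V}) f1 f2 f3 :
    f1 \in X -> f2 \in X -> f3 \in X -> f1 != 0 -> f2 != 0 -> f3 != 0 ->
    f2 \notin <[f1]>%VS -> f3 \notin <[f1]>%VS -> f3 \notin <[f2]>%VS ->
    (forall (a : F) f, a != 0 -> f \in X -> a *: f \in X) ->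
  (3 * q1 <= #|X|)%N.
Proof.
move=> X1 X2 X3 n1 n2 n3 f21 f31 f32 XZ.
have sub : punctured f1 :|: punctured f2 :|: punctured f3 \subset X.
  by rewrite !subUset !punctured_sub.
apply: leq_trans (subset_leq_card sub); rewrite cardsU.
rewrite setIUl !disjoint_setI0 ?punctured_disjoint // setU0 cards0 subn0 cardsU.
rewrite disjoint_setI0 ?punctured_disjoint // cards0 !card_punctured //.
by rewrite subn0; clear; lia.
Qed.

Lemma card_vline_image (T : finType) (g : V -> T) (Z : {set V}) :
    0 \notin Z -> (forall (a : F) f, a != 0 -> f \in Z -> a *: f \in Z) ->
    (forall f f', g f = g f' <-> <[f]>%VS = <[f']>%VS) ->
  #|Z| = (#|g @: Z| * q1)%N.
Proof.
move=> Z0 ZZ gE; rewrite -sum1_card (partition_big_imset g) /= -sum_nat_const.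
apply: eq_bigr => _ /imsetP[f fZ ->].
have f0 : f != 0 by apply: contraNneq Z0 => <-.
rewrite sum1_card -(card_punctured f0); apply: eq_card => y.
rewrite unfold_in !inE memv0; apply/andP/andP => [[yZ /eqP/gE yf]|[/vlineP[k ->] kf]].
  split; first by rewrite -yf memv_line.
  by apply: contraNneq Z0 => <-.
have k0 : k != 0 by apply: contraNneq kf => ->; rewrite scale0r.
by split; [apply: ZZ | apply/eqP/gE; apply: vline_scale].
Qed.

(** * The case R = q + 1 *)

Section Hyperoval.

Hypothesis card_A0 : #|A| = (w * (q1 * q))%N.

Lemma card_fullI P : P \in A -> #|full P| = (q * q1 * (q + 1))%N.
Proof.
move=> PA; have [//|fullE] := card_full PA.
have := card_A (d := 1) PA fullE isT; rewrite card_A0 => /eqP.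
by rewrite eqn_pmul2l ?muln_gt0 // eqn_pmul2l // -{1}[q]addn0 eqn_add2l.
Qed.

Lemma card_zerosI : #|zeros| = (q1 * (q + 2))%N.
Proof. by apply: (@card_zeros 0); rewrite ?addn0 //; left. Qed.

Lemma exists_zeroI : exists f, f \in zeros.
Proof. by apply/card_gt0P; rewrite card_zerosI muln_gt0 addn2. Qed.

(** By [plane_zeros], every missing hyperplane cuts the plane of full lines on P in the same line,
    its part outside A. *)
Lemma plane_vertex P : P \in A -> exists2 l : {vspace V}, \dim l = 2%N &
  [/\ forall x, x \in l -> x \notin A, {in zeros & l, forall f x, dot x f = 0}
    & forall x, x \in (<[P]> + l)%VS -> x \notin l -> x \in A].
Proof.
move=> PA; have [pi dpi [Ppi _ cpi]] := full_plane PA (card_fullI PA).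
have [f0 f0Z] := exists_zeroI.
have [dl piE] := plane_zeros dpi cpi f0Z.
exists (pi :&: orth <[f0]>)%VS => //; split=> [x|f x fZ|x].
- rewrite memv_cap orth_lineE => /andP[xpi /eqP xf0].
  by rewrite (piE x xpi) xf0 eqxx.
- rewrite memv_cap orth_lineE => /andP[xpi xf0].
  have [_ piE'] := plane_zeros dpi cpi fZ.
  by apply/eqP; rewrite -[_ == _]negbK -piE' // piE // xf0.
move=> xPl; have xpi : x \in pi.
  by apply: subvP xPl; rewrite subv_add -memvE Ppi capvSl.
by rewrite memv_cap xpi orth_lineE piE.
Qed.

Lemma common_vertex : exists2 l : {vspace V}, \dim l = 2%N &
  [/\ forall x, x \in l -> x \notin A, {in zeros & l, forall f x, dot x f = 0}
    & forall P x, P \in A -> x \in (<[P]> + l)%VS -> x \notin l -> x \in A].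
Proof.
have [P PA] := exists_A; have [l dl [lA lZ lP]] := plane_vertex PA.
exists l => //; split=> // P' x P'A.
have [l' dl' [_ l'Z lP']] := plane_vertex P'A.
suff -> : l = l' by apply: lP'.
apply/eqP; rewrite eqEdim dl dl' leqnn andbT.
(* If the lines differed, [zeros] would lie in a 2-dimensional space, whose q + 1 points are fewer
   than the q + 2 of [card_zerosI]. *)
apply/negPn/negP => /subvPn[u ul ul'].
have dlu : \dim (l' + <[u]>) = 3%N by rewrite dim_addv_line ?dl'.
have sub : zeros \subset [set f in orth (l' + <[u]>) | f \notin 0%VS].
  apply/subsetP => f fZ; rewrite inE memv0; apply/andP; split.
    apply/orthP => z /memv_addv_lineP[z' z'l' [k ->]].
    by rewrite dotDr dotZr !(dotC f) l'Z // lZ // mulr0 addr0.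
  by move: fZ; rewrite inE => /andP[].
have := subset_leq_card sub; rewrite card_zerosI.
have := card_vspaceD (sub0v (orth (l' + <[u]>))).
rewrite !card_vspace_q dimv0 dim_orth dlu expn0 /=.
by rewrite -[(5 - 3)%N]/2%N; move: #|_| => c; clear; lia.
Qed.

(** For a off l, the plane l + <a> misses A, so its q + 1 hyperplanes partition A. If none missed A,
    they would hold at least (q + 1) [small] vectors, while #|A| is q times [small]. *)
Lemma zero_perp a : a \notin A -> exists2 f, f \in zeros & dot a f = 0.
Proof.
move=> aA; have [l dl [lA lZ lP]] := common_vertex.
have [al|al] := boolP (a \in l).
  by have [f fZ] := exists_zeroI; exists f => //; apply: lZ.
have da : \dim (l + <[a]>) = 3%N by rewrite dim_addv_line ?dl.
have cnt0 : cnt A (l + <[a]>) = 0%N.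
  apply: eq_card0 => P; rewrite !inE; apply/negP => /andP[PA Pla].
  have Pl : P \notin l by apply/negP => /lA; rewrite PA.
  have aPl := memv_addv_line_exchange Pl Pla.
  by move: aA; rewrite (lP P) // addvC.
have := sum_cnt_orth_disjoint cnt0.
rewrite (bigD1 0) ?mem0v //= cnt_orth0 card_F card_vspace_q dim_orth da => E.
have [f /andP[fZ fla]|noZ] := pickP [pred f in zeros | f \in orth (l + <[a]>)%VS].
  exists f => //; rewrite dotC; move/orthP: fla; apply.
  by rewrite memvE addvSr.
have : (w * q1 * (q ^ 2 - 1) <= \sum_(f in orth (l + <[a]>) | f != 0%R) cnt A (orth <[f]>))%N.
  have -> : (q ^ 2 - 1 = \sum_(f in orth (l + <[a]>) | f != 0%R) 1)%N.
    have := card_vspace_q (orth (l + <[a]>)).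
    rewrite dim_orth da -sum1_card (bigD1 0) ?mem0v //= => <-; first by rewrite addKn.
  rewrite big_distrr /=; apply: leq_sum => f /andP[fla f0]; rewrite muln1.
  have := A_hyperplane f0; rewrite !inE => /or3P[]/eqP cE.
  - by have := noZ f; rewrite /= !inE f0 cE fla.
  - by rewrite cE leq_pmul2l ?muln_gt0 //.
  by rewrite cE.
move: E; rewrite card_A0 (mulnA w) -[(5 - 3)%N]/2%N.
have W_gt0 : (0 < w * q1)%N by rewrite !muln_gt0.
move: (\sum_(f in orth (l + <[a]>) | f != 0%R) cnt A (orth <[f]>))%N => S.
move: (w * q1)%N W_gt0 => W W_gt0 E leS.
have {}E : (W * q + S = q * (W * q))%N.
  by apply/eqP; rewrite -(@eqn_pmul2l q) // E expnS expn1 !mulnA.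
suff : (W * (q ^ 2 - 1) + W * q <= q * (W * q))%N.
  rewrite -mulnDr mulnCA leq_pmul2l //; clear; lia.
by rewrite -E addnC leq_add2l.
Qed.

(** [orth L] misses A, so the q + 1 hyperplanes on it partition A. With three of them missing A, the
    rest hold at most (q - 2) [big] vectors, while #|A| is q - 1 times [big]. *)
Lemma zeros_no_line (L : {vspace V}) (f1 f2 f3 : V) : \dim L = 2%N ->
    {subset [:: f1; f2; f3] <= zeros} -> {subset [:: f1; f2; f3] <= L} ->
  ~ [/\ f2 \notin <[f1]>%VS, f3 \notin <[f1]>%VS & f3 \notin <[f2]>%VS].
Proof.
move=> dL fZ fL [f21 f31 f32].
have [f1Z f2Z f3Z] : [/\ f1 \in zeros, f2 \in zeros & f3 \in zeros].
  by split; apply: fZ; rewrite !inE eqxx ?orbT.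
have [f1L f2L f3L] : [/\ f1 \in L, f2 \in L & f3 \in L].
  by split; apply: fL; rewrite !inE eqxx ?orbT.
have cnt0 : cnt A (orth L) = 0%N.
  apply: eq_card0 => P; rewrite !inE; apply/negP => /andP[PA /orthP PL].
  by move: (mem_zeros f1Z PA); rewrite PL ?eqxx.
have := sum_cnt_orth_disjoint cnt0; rewrite orthK card_vspace_q dL card_F.
rewrite (bigD1 0) ?mem0v //= cnt_orth0 => E.
pose Z := [set f in zeros | f \in L].
have cardZ : (3 * q1 <= #|Z|)%N.
  have zne f : f \in zeros -> f != 0 by rewrite inE => /andP[].
  have ZI f : f \in zeros -> f \in L -> f \in Z by move=> fz fl; rewrite inE fz.
  apply: (@card_three_lines Z f1 f2 f3); try by [apply: ZI | apply: zne |].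
  move=> a f a0; rewrite !inE => /andP[/andP[f0 fA] fL']; rewrite memvZ // andbT.
  by rewrite scaler_eq0 negb_or a0 f0 vline_scale.
have cardL : (\sum_(f in L | f != 0%R) 1 + 1 = q ^ 2)%N.
  have := card_vspace_q L; rewrite dL => <-.
  by rewrite -[RHS]sum1_card [RHS](bigD1 (0 : V)) ?mem0v //= addnC.
have : (\sum_(f in L | f != 0%R) (cnt A (orth <[f]>) + w * q * (f \in Z)) <=
    \sum_(f in L | f != 0%R) (w * q * 1))%N.
  apply: leq_sum => f /andP[fL' f0]; rewrite !inE f0 fL' andbT muln1.
  have := A_hyperplane f0; rewrite !inE => /or3P[]/eqP ->.
  - by rewrite eqxx muln1.
  - by rewrite muln_eq0 /= !muln0 addn0.
  by rewrite muln_eq0 /= !muln0 addn0 leq_pmul2l ?muln_gt0.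
rewrite big_split /= -!big_distrr /=.
have -> : (\sum_(f in L | f != 0%R) (f \in Z) = #|Z|)%N.
  rewrite -sum1_card big_mkcond [RHS]big_mkcond; apply: eq_bigr => f _.
  by rewrite !inE; case: (f \in L) => //=; case: (f != 0) => //=; rewrite ?andbT ?andbF //; case: eqP.
move: E cardL; rewrite card_A0.
move: (\sum_(f in L | f != 0%R) cnt A (orth <[f]>))%N (\sum_(f in L | f != 0%R) 1)%N => S T.
rewrite (mulnA w) (mulnAC w).
move: (w * q)%N (isT : 0 < w * q)%N #|Z| cardZ => W W_gt0 z cardZ E cardL leS.
have {}E : (W * q1 + S = q * (W * q1))%N.
  by apply/eqP; rewrite -(@eqn_pmul2l q) // E expnS expn1 !mulnA.
have : (q * (W * q1) + W * (3 * q1) <= W * q1 + W * T)%N.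
  by rewrite -E -addnA leq_add2l (leq_trans _ leS) // leq_add2l leq_mul2l cardZ orbT.
rewrite mulnCA -!mulnDr leq_pmul2l //; move: cardL; clear; lia.
Qed.

Lemma hyperoval_structure : exists (W : {vspace V}) (H : {set {vspace V}}),
  hyperoval W H /\ forall a, a != 0 -> a \in A <-> section H (orth <[a]>) = set0.
Proof.
have [l dl [_ lZ _]] := common_vertex.
have zeros_neq0 f : f \in zeros -> f != 0 by rewrite inE => /andP[].
exists (orth l), [set <[f]>%VS | f : V in zeros]; split; last first.
  move=> a a0; split=> [aA|Hset0].
    apply/setP => P; rewrite [in RHS]inE inE; apply/andP => -[/imsetP[f fZ ->]].
    by rewrite -memvE orth_lineE dotC; apply/negP; apply: mem_zeros.
  apply: contraT => aA; have [f fZ fa] := zero_perp aA.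
  have : <[f]>%VS \in section [set <[f]>%VS | f : V in zeros] (orth <[a]>).
    by rewrite inE imset_f //= -memvE orth_lineE dotC fa.
  by rewrite Hset0 inE.
split.
- by apply/eqP; rewrite dim_orth dl.
- move=> _ /imsetP[f fZ ->]; rewrite /point dim_vline zeros_neq0 // eqxx -memvE /=.
  by apply/orthP => x xl; rewrite dotC lZ.
- have zerosZ' (a : F) f : a != 0 -> f \in zeros -> a *: f \in zeros.
    move=> a0; rewrite !inE => /andP[f0 fA].
    by rewrite vline_scale // fA scaler_eq0 negb_or a0 f0.
  have zeros0 : 0 \notin zeros by rewrite inE eqxx.
  have := @card_vline_image _ (fun f : V => <[f]>%VS) _ zeros0 zerosZ' (fun _ _ => iff_refl _).
  by rewrite card_zerosI mulnC => /eqP; rewrite eqn_pmul2r // card_F => /eqP.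
move=> _ _ _ /imsetP[f1 f1Z ->] /imsetP[f2 f2Z ->] /imsetP[f3 f3Z ->] uniqf.
case=> L /eqP dL []; rewrite -!memvE => f1L f2L f3L.
have notin f g : f \in zeros -> g \in zeros -> <[f]>%VS != <[g]>%VS -> g \notin <[f]>%VS.
  move=> fZ gZ; apply: contraNN => /vlineP[k gE]; rewrite gE vline_scale //.
  by apply: contraTneq gZ => k0; rewrite gE k0 scale0r inE eqxx.
apply: (@zeros_no_line L f1 f2 f3 dL).
- by move=> f; rewrite !in_cons orbF => /or3P[]/eqP->.
- by move=> f; rewrite !in_cons orbF => /or3P[]/eqP->.
move: uniqf; rewrite /= !inE negb_or andbT => /andP[/andP[f12 f13] f23].
by split; apply: notin.
Qed.

End Hyperoval.

(** * The case R = q^2 + 1 *)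

Section Quadric.

Hypothesis card_A1 : #|A| = (w * (q1 * (q + 1)))%N.
Hypothesis pchar2 : 2 \in [pchar F].
Variable nu : V.
Hypothesis nuZ : nu \in zeros.

Lemma nu_neq0 : nu != 0.
Proof. by move: nuZ; rewrite inE => /andP[]. Qed.

Lemma zerosZ (a : F) f : a != 0 -> f \in zeros -> a *: f \in zeros.
Proof.
move=> a0; rewrite !inE => /andP[f0 fA].
by rewrite vline_scale // fA scaler_eq0 negb_or a0 f0.
Qed.

Lemma zerosE : zeros = punctured nu.
Proof.
apply/esym/eqP; rewrite eqEcard punctured_sub //=; last exact: zerosZ.
by rewrite (@card_zeros 1 q1) ?card_punctured ?nu_neq0 //; right.
Qed.

Definition singulars := [set f : V | (f != 0) && (cnt A (orth <[f]>) == small)].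

Lemma singularsZ (a : F) f : a != 0 -> f \in singulars -> a *: f \in singulars.
Proof.
move=> a0; rewrite !inE => /andP[f0 fA].
by rewrite vline_scale // fA scaler_eq0 negb_or a0 f0.
Qed.

Lemma singular_neq0 f : f \in singulars -> f != 0.
Proof. by rewrite inE => /andP[]. Qed.

Lemma singular_not_nu f : f \in singulars -> f \notin <[nu]>%VS.
Proof.
rewrite inE => /andP[f0 /eqP fE]; apply/negP => fnu.
have : f \in zeros by rewrite zerosE inE fnu memv0.
by rewrite inE f0 fE !muln_eq0.
Qed.

(** * Singular points on lines of the dual space *)

Lemma sum_singulars L : \dim L = 2%N ->
  (w * (q1 * (q + 1)) * q1 + q * q1 * cnt A (orth L) + w * cnt singulars L
    + w * q * cnt zeros L = w * q * (q * q - 1))%N.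
Proof.
move=> dL.
have Lsum (G : V -> nat) : (\sum_(f in L) G f = G 0%R + \sum_(f in L | f != 0%R) G f)%N.
  by rewrite (bigD1 0) ?mem0v.
have cardL : (q * q - 1 = \sum_(f in L | f != 0%R) 1)%N.
  have := card_vspace_q L; rewrite dL expnS expn1 => <-.
  by rewrite -sum1_card Lsum addKn.
have cntL (B : {set V}) : 0 \notin B -> (cnt B L = \sum_(f in L | f != 0%R) (f \in B))%N.
  move=> B0; rewrite /cnt -sum1_card big_mkcond [RHS]big_mkcond; apply: eq_bigr => f _.
  rewrite inE; have [->|] := eqVneq f 0; first by rewrite (negPf B0) andbF.
  by case: (f \in B); case: (f \in L).
have split_sum (a b : nat) :
    (\sum_(f in L | f != 0%R) (cnt A (orth <[f]>) + a * (f \in singulars) + b * (f \in zeros)) =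
     \sum_(f in L | f != 0%R) cnt A (orth <[f]>) + a * cnt singulars L + b * cnt zeros L)%N.
  by rewrite !big_split -!big_distrr -!cntL ?inE ?eqxx.
have const_sum (a : nat) : (\sum_(f in L | f != 0%R) a * 1 = a * (q * q - 1))%N.
  by rewrite -big_distrr -cardL.
(* Every term is raised to [big]: a singular member lacks w, a missing one lacks w q. *)
have : (\sum_(f in L | f != 0%R) (cnt A (orth <[f]>) + w * (f \in singulars) + w * q * (f \in zeros))
    = \sum_(f in L | f != 0%R) w * q * 1)%N.
  apply: eq_bigr => f /andP[fL f0]; have := A_hyperplane f0.
  have qq1 : (w * q == w * q1)%N = false by rewrite eqn_pmul2l ?muln_gt0 // eqn_leq ltnn.
  have w0 : (w * q1 == 0)%N = false by rewrite !muln_eq0.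
  have w0' : (w * q == 0)%N = false by rewrite !muln_eq0.
  rewrite !inE f0 => /or3P[]/eqP ->.
  - by rewrite [(0 == small)%N]eq_sym w0 eqxx muln0 muln1.
  - by rewrite qq1 w0' !muln0 !addn0 muln1.
  by rewrite eqxx w0 muln0 !muln1 addn0 addnC -mulnS.
rewrite split_sum const_sum.
have := sum_cnt_orth A L; rewrite Lsum cnt_orth0 card_vspace_q dL card_F card_A1.
move: (\sum_(_ in _ | _) _)%N (cnt A _) (cnt _ L) (cnt _ L) => S C b z E.
have {}E : (w * (q1 * (q + 1)) + S + q * C = q * (w * (q1 * (q + 1))) + q * q * C)%N.
  apply/eqP; rewrite -(@eqn_pmul2l q) //; apply/eqP; move: E; rewrite expnS expn1.
  by move: (w * _)%N => W; clear; lia.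
rewrite -addnA => <-; rewrite -[LHS]addnA; congr (_ + _)%N.
by move: E; move: (w * (q1 * (q + 1)))%N => W; clear; lia.
Qed.

Lemma mem_zeros_nu x : x \in A -> dot x nu != 0.
Proof. exact: mem_zeros. Qed.

Lemma sqr_q_pred : (q * q - 1 = q1 * (q + 1))%N.
Proof. by clear; lia. Qed.

Lemma cnt_singulars_nu L : \dim L = 2%N -> nu \in L -> cnt singulars L = q1.
Proof.
move=> dL nuL; have := sum_singulars dL.
have -> : cnt A (orth L) = 0%N.
  apply: eq_card0 => x; rewrite !inE; apply/negP => /andP[xA /orthP/(_ nu nuL) xnu].
  by move: (mem_zeros_nu xA); rewrite xnu eqxx.
have -> : cnt zeros L = q1.
  rewrite -(card_punctured nu_neq0) zerosE; apply: eq_card => x.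
  rewrite [LHS]inE andb_idr // !inE => /andP[/vlineP[k ->] _].
  by rewrite memvZ.
rewrite muln0 addn0 sqr_q_pred => E.
apply/eqP; rewrite -(@eqn_pmul2l w) //; apply/eqP; move: E.
by move: w (cnt _ L) => W z; clear; lia.
Qed.

Lemma cnt_singulars_line L : \dim L = 2%N -> nu \notin L ->
  (cnt A (orth L) + h * cnt singulars L = h * (q1 * (q + 1)))%N.
Proof.
move=> dL nuL; have := sum_singulars dL.
have -> : cnt zeros L = 0%N.
  apply: eq_card0 => x; rewrite zerosE !inE memv0; apply/negP => /andP[/andP[/vlineP[k ->] k0] kL].
  have k0' : k != 0 by apply: contraNneq k0 => ->; rewrite scale0r.
  by move: nuL; rewrite -[nu](scalerK k0') memvZ.
rewrite muln0 addn0 sqr_q_pred; move: (cnt _ L) (cnt A _) => z C.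
move=> E; apply/eqP; rewrite -(@eqn_pmul2l (q * q1)) //; apply/eqP.
by move: E; clear; lia.
Qed.

(** Three singular points leave at most e q points of A in the plane [orth L]. But if it has a point
    P of A, each of its q + 1 lines on P has at least e further ones. *)
Lemma singulars_line_full L : \dim L = 2%N -> nu \notin L -> (3 * q1 <= cnt singulars L)%N ->
  cnt A (orth L) = 0%N /\ {in L, forall f, f != 0 -> f \in singulars}.
Proof.
move=> dL nuL; have := cnt_singulars_line dL nuL.
have [->|] := posnP (cnt A (orth L)) => [E _ | ].
  split=> // f fL f0.
  have zE : cnt singulars L = (q1 * (q + 1))%N.
    by apply/eqP; rewrite -(@eqn_pmul2l h) // -E.
  have sub : [set g in singulars | g \in L] \subset [set g in L | g \notin 0%VS].
    by apply/subsetP => g; rewrite !inE memv0 => /andP[/andP[-> _] ->].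
  have /eqP eqL : [set g in singulars | g \in L] == [set g in L | g \notin 0%VS].
    rewrite eqEcard sub [#|[set g in singulars | _]|]zE.
    have := card_vspaceD (sub0v L); rewrite !card_vspace_q dL dimv0 expn0.
    by move: #|_| => c; clear; lia.
  have : f \in [set g in L | g \notin 0%VS] by rewrite inE fL memv0.
  by rewrite -eqL inE => /andP[].
case/card_gt0P => P; rewrite inE => /andP[PA PL] E1 E2.
have := cnt_full PA PL; rewrite card_vspace_q dim_orth dL -[(5 - 2)%N]/3%N.
move: (cnt A (orth L)) (cnt singulars L) (cnt (full P) (orth L)) E1 E2 => C z r E1 E2 E3.
exfalso; move: E1 E2 E3; clear; nia.
Qed.

Lemma two_singulars L f g : f \in singulars -> g \in singulars -> f \in L -> g \in L ->
  g \notin <[f]>%VS -> (2 * q1 <= cnt singulars L)%N.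
Proof.
move=> fX gX fL gL gf; have memX u : u \in singulars -> u \in L ->
  u \in [set u in singulars | u \in L] by move=> uX uL; rewrite inE uX.
apply: (@card_two_lines _ f g) => //; try by [apply: memX | apply: singular_neq0].
by move=> a u a0; rewrite [in X in X -> _]inE => /andP[uX uL]; apply: memX;
  rewrite ?singularsZ ?memvZ.
Qed.

Lemma three_singulars L f g k :
  f \in singulars -> g \in singulars -> k \in singulars -> f \in L -> g \in L -> k \in L ->
  g \notin <[f]>%VS -> k \notin <[f]>%VS -> k \notin <[g]>%VS -> (3 * q1 <= cnt singulars L)%N.
Proof.
move=> fX gX kX fL gL kL gf kf kg; have memX u : u \in singulars -> u \in L ->
  u \in [set u in singulars | u \in L] by move=> uX uL; rewrite inE uX.
apply: (@card_three_lines _ f g k) => //; try by [apply: memX | apply: singular_neq0].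
by move=> a u a0; rewrite [in X in X -> _]inE => /andP[uX uL]; apply: memX;
  rewrite ?singularsZ ?memvZ.
Qed.

(** * The height function *)

Definition on_quadric (f : V) := (f == 0) || (f \in singulars).

Lemma on_quadricZ (a : F) f : on_quadric f -> on_quadric (a *: f).
Proof.
rewrite /on_quadric scaler_eq0; have [//|a0 /orP[->//|fX]] := eqVneq a 0.
by rewrite singularsZ ?orbT.
Qed.

Lemma on_quadric_nu_uniq x s t :
  on_quadric (x + s *: nu) -> on_quadric (x + t *: nu) -> s = t.
Proof.
have [/vlineP[k ->]|xnu] := boolP (x \in <[nu]>%VS).
  have only0 r : on_quadric (k *: nu + r *: nu) -> k + r = 0.
    rewrite -scalerDl => /orP[|/singular_not_nu]; last by rewrite memvZ ?memv_line.
    by rewrite scaler_eq0 (negPf nu_neq0) orbF => /eqP.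
  by move=> /only0 ks /only0; rewrite -ks => /addrI.
have in_singulars r : on_quadric (x + r *: nu) -> x + r *: nu \in singulars.
  case/orP => // /eqP; move/(canRL (addrK _)); rewrite add0r -scaleNr => xE.
  by move: xnu; rewrite xE memvZ ?memv_line.
move=> /in_singulars sX /in_singulars tX; apply/eqP/negPn/negP => st.
have dL : \dim (<[nu]> + <[x]>) = 2%N by rewrite dim_line2 ?nu_neq0.
have inL r : x + r *: nu \in (<[nu]> + <[x]>)%VS.
  by rewrite addrC memv_add ?memvZ ?memv_line.
have nu_in : nu \in (<[nu]> + <[x]>)%VS by rewrite memvE addvSl.
have /negP : ~~ (2 * q1 <= cnt singulars (<[nu]> + <[x]>))%N.
  by rewrite (cnt_singulars_nu dL nu_in); clear; lia.
apply; apply: (two_singulars sX tX); rewrite ?inL //; apply/negP => /vlineP[k kE].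
have xE : (1 - k) *: x = (k * s - t) *: nu.
  apply/eqP; rewrite !scalerBl scale1r -scalerA subr_eq addrAC eq_sym subr_eq.
  by rewrite kE scalerDr addrC.
have [k1|k1] := eqVneq (1 - k) 0; last first.
  by move: xnu; rewrite -(scalerK k1 x) xE !memvZ ?memv_line.
move: xE; rewrite k1 scale0r => /esym/eqP; rewrite scaler_eq0 (negPf nu_neq0) orbF.
by move/eqP: k1; rewrite subr_eq0 => /eqP<-; rewrite mul1r subr_eq0 (negPf st).
Qed.

(** The square root of the future quadratic form, whose nucleus is nu. By [heightP] the default
    value is never the result of a failed search. *)
Definition height (x : V) : F := odflt 0 [pick t | on_quadric (x + t *: nu)].

Lemma heightP x : on_quadric (x + height x *: nu).
Proof.
rewrite /height; case: pickP => [//|no].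
have [/vlineP[k xE]|xnu] := boolP (x \in <[nu]>%VS).
  by have := no (- k); rewrite xE -scalerDl subrr scale0r /on_quadric eqxx.
have dL : \dim (<[nu]> + <[x]>) = 2%N by rewrite dim_line2 ?nu_neq0.
have : (0 < cnt singulars (<[nu]> + <[x]>))%N.
  by rewrite cnt_singulars_nu // memvE addvSl.
case/card_gt0P => f; rewrite inE => /andP[fX /memv_addv_lineP[_ /vlineP[a ->] [b fE]]].
have b0 : b != 0.
  apply: contraTneq fX => b0; apply/negP => /singular_not_nu.
  by rewrite fE b0 scale0r addr0 memvZ ?memv_line.
have := no (b^-1 * a); rewrite /on_quadric -[x in x + _](scalerK b0) -scalerA -scalerDr.
by rewrite addrC -fE singularsZ ?invr_eq0 ?orbT.
Qed.

Lemma height_eq x t : on_quadric (x + t *: nu) -> height x = t.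
Proof. exact: on_quadric_nu_uniq (heightP x). Qed.

Lemma heightZ (a : F) x : height (a *: x) = a * height x.
Proof.
by apply: height_eq; rewrite -scalerA -scalerDr; apply: on_quadricZ (heightP x).
Qed.

Lemma height_nu x t : height (x + t *: nu) = height x + t.
Proof.
apply: height_eq; rewrite -addrA -scalerDl addrCA (addrr_pchar2 pchar2) addr0.
exact: heightP.
Qed.

Lemma height0E x : (height x == 0) = on_quadric x.
Proof.
apply/eqP/idP => [hx|xX]; first by have := heightP x; rewrite hx scale0r addr0.
by apply: height_eq; rewrite scale0r addr0.
Qed.

Lemma singular_height x : x \in singulars -> height x = 0.
Proof. by move=> xX; apply/eqP; rewrite height0E /on_quadric xX orbT. Qed.

Lemma height0_singular x : x != 0 -> height x = 0 -> x \in singulars.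
Proof. by move=> x0 /eqP; rewrite height0E /on_quadric (negPf x0). Qed.

Lemma singular_shift x : x \notin <[nu]>%VS -> x + height x *: nu \in singulars.
Proof.
move=> xnu; case/orP: (heightP x) => // /eqP /(canRL (addrK _)).
rewrite add0r -scaleNr => xE.
by move: xnu; rewrite {1}xE memvZ ?memv_line.
Qed.

(** The hyperplane of v contains a full line on any of its points P in A. The one point of this line
    outside A must be its point Z on the hyperplane of nu, which misses A. *)
Lemma tangent_point v : v \in singulars -> exists P Z,
  [/\ P \in A, Z \in full P, dot Z nu = 0, v \in orth (<[P]> + <[Z]>)
    & forall u, u \in (<[P]> + <[Z]>)%VS -> u \notin <[Z]>%VS -> u \in A].
Proof.
move=> vX; have v0 := singular_neq0 vX.
have vE : cnt A (orth <[v]>) = small by move: vX; rewrite inE => /andP[_ /eqP].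
have [P PA Pv] : exists2 P, P \in A & P \in orth <[v]>%VS.
  have : (0 < cnt A (orth <[v]>))%N by rewrite vE.
  by case/card_gt0P => P; rewrite inE => /andP[]; exists P.
have [y yP yv] : exists2 y, y \in full P & y \in orth <[v]>%VS.
  have : (0 < cnt (full P) (orth <[v]>))%N.
    have [[_ ->]|[_ ->]] := cnt_full_hyperplane PA v0 Pv => //.
  by case/card_gt0P => y; rewrite inE => /andP[]; exists y.
have Pnu := mem_zeros_nu PA.
pose Z := y - (dot y nu / dot P nu) *: P.
have Znu : dot Z nu = 0 by rewrite dotDl -scaleNr dotZl mulNr divfK // subrr.
have yP' : y \notin <[P]>%VS by move: yP; rewrite inE => /andP[].
have ZPy : Z \in (<[P]> + <[y]>)%VS.
  by rewrite /Z addrC -scaleNr memv_add ?memvZ ?memv_line.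
have ZP : Z \notin <[P]>%VS.
  apply: contraNN yP' => ZP; rewrite -(subrK ((dot y nu / dot P nu) *: P) y).
  by rewrite memvD ?memvZ ?memv_line.
have Zfull := full_shift yP ZP ZPy.
exists P, Z; split=> //.
  rewrite orthD memv_cap !orth_lineE !(dotC v) -!orth_lineE Pv.
  by rewrite memvB ?memvZ.
have dL : \dim (<[P]> + <[Z]>) = 2%N by rewrite dim_line2 ?A_neq.
have Z0 : Z != 0 by apply: contraNneq ZP => ->; apply: mem0v.
have cL : cnt A (<[P]> + <[Z]>) = (q1 * q)%N by move: Zfull; rewrite inE => /andP[_ /eqP].
have sub : [set u in A | u \in (<[P]> + <[Z]>)%VS] \subset
    [set u in (<[P]> + <[Z]>)%VS | u \notin <[Z]>%VS].
  apply/subsetP => u; rewrite !inE => /andP[uA ->] /=.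
  by apply/negP => /vlineP[k uE]; move: (mem_zeros_nu uA); rewrite uE dotZl Znu mulr0 eqxx.
have /eqP eqL : [set u in A | u \in (<[P]> + <[Z]>)%VS] ==
    [set u in (<[P]> + <[Z]>)%VS | u \notin <[Z]>%VS].
  rewrite eqEcard sub [#|[set u in A | _]|]cL.
  have := card_vspaceD (addvSr <[P]> <[Z]>); rewrite !card_vspace_q dL dim_vline Z0.
  by rewrite expn1; move: #|_| => c; clear; lia.
move=> u uL uZ; have : u \in [set u in (<[P]> + <[Z]>)%VS | u \notin <[Z]>%VS].
  by rewrite inE uL.
by rewrite -eqL inE => /andP[].
Qed.

(** * Tangent hyperplanes as zero sets of the defect *)

Notation D := (defect height).

Let defect_nu' := defect_nu pchar2 height_nu.

Lemma vline_sym x y : x != 0 -> x \in <[y]>%VS -> y \in <[x]>%VS.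
Proof.
move=> x0 /vlineP[k xE]; rewrite xE vline_scale ?memv_line //.
by apply: contraNneq x0 => k0; rewrite xE k0 scale0r.
Qed.

Lemma not_nu_in_line v y : v != 0 -> nu \in (<[v]> + <[y]>)%VS -> v \notin <[nu]>%VS ->
  y \in (<[nu]> + <[v]>)%VS.
Proof.
move=> v0 nuL vnu; rewrite addvC; apply: memv_addv_line_exchange => //.
apply/negP => /vlineP[k nuE]; move: vnu; rewrite nuE vline_scale ?memv_line //.
by apply: contraNneq nu_neq0 => k0; rewrite nuE k0 scale0r.
Qed.

(** D v y = 0 makes v + y a third singular point on the line of v and y. *)
Lemma defect_singular_line v y : v \in singulars -> y \in singulars ->
    y \notin (<[nu]> + <[v]>)%VS -> D v y = 0 ->
  \dim (<[v]> + <[y]>) = 2%N /\ cnt A (orth (<[v]> + <[y]>)) = 0%N.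
Proof.
move=> vX yX ynv; rewrite /defect (singular_height vX) (singular_height yX) !addr0 => vy.
have v0 := singular_neq0 vX.
have yv : y \notin <[v]>%VS.
  by apply: contraNN ynv; apply/subvP; apply: addvSr.
have dL : \dim (<[v]> + <[y]>) = 2%N by rewrite dim_line2.
split=> //; have vyX : v + y \in singulars.
  apply: height0_singular => //; apply: contraNneq yv => /eqP.
  by rewrite addrC addr_eq0 => /eqP ->; rewrite memvN memv_line.
have nuL : nu \notin (<[v]> + <[y]>)%VS.
  by apply: contraNN ynv => nuL; apply: not_nu_in_line (singular_not_nu vX).
have vL : v \in (<[v]> + <[y]>)%VS by rewrite memvE addvSl.
have yL : y \in (<[v]> + <[y]>)%VS by rewrite memvE addvSr.
apply: (singulars_line_full dL nuL _).1.
apply: (three_singulars vX yX vyX) => //; first by rewrite memvD.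
  by apply: contraNN yv => vy'; rewrite -[y](addKr v) memvD ?memvN ?memv_line.
apply: contraNN yv => vyy; apply: vline_sym v0 _.
by rewrite -(addrK y v) memvB ?memv_line.
Qed.

(** The normal is the Z of [tangent_point]. Multiples of nu change neither side, so outside the line
    on nu and v only singular y need comparing. *)
Lemma tangent_singular v : v \in singulars ->
  exists2 z, z != 0 & forall y, (D v y == 0) = (dot z y == 0).
Proof.
move=> vX; have v0 := singular_neq0 vX; have vnu := singular_not_nu vX.
have [P [Z [PA ZP Znu vPZ PZA]]] := tangent_point vX.
have Pnu := mem_zeros_nu PA.
have ZP' : Z \notin <[P]>%VS by move: ZP; rewrite inE => /andP[].
have dPZ : \dim (<[P]> + <[Z]>) = 2%N by rewrite dim_line2 ?A_neq.
have [Pv Zv] : dot P v = 0 /\ dot Z v = 0.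
  move: vPZ; rewrite orthD memv_cap !orth_lineE !(dotC v).
  by case/andP => /eqP -> /eqP ->.
exists Z; first by apply: contraNneq ZP' => ->; apply: mem0v.
have fwd y : y \in singulars -> y \notin (<[nu]> + <[v]>)%VS -> D v y = 0 -> dot Z y = 0.
  move=> yX ynv vy; have [dL C0] := defect_singular_line vX yX ynv vy.
  (* This plane and this line lie in the solid of v, so they meet. The plane misses A, so they meet
     in Z. *)
  pose I := (orth (<[v]> + <[y]>) :&: (<[P]> + <[Z]>))%VS.
  have : (0 < \dim I)%N.
    have := dimv_sum_cap (orth (<[v]> + <[y]>)) (<[P]> + <[Z]>).
    have : (\dim (orth (<[v]> + <[y]>) + (<[P]> + <[Z]>)) <= \dim (orth <[v]>))%N.
      apply: dimvS; rewrite subv_add; apply/andP; split.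
        by apply: orthS; apply: addvSl.
      by rewrite subv_add -!memvE !orth_lineE Pv Zv eqxx.
    rewrite [\dim (orth <[v]>)]dim_orth dim_vline v0 dim_orth dL dPZ -/I.
    by move: (\dim (_ + _)%VS) (\dim I) => d i; clear; lia.
  rewrite lt0n dimv_eq0 => /negP I0; have [u uI u0] : exists2 u, u \in I & u != 0.
    have : ~~ (I <= 0)%VS by rewrite subv0; apply/negP.
    by case/subvPn => u uI; rewrite memv0; exists u.
  move: uI; rewrite memv_cap => /andP[uL uPZ].
  have uZ : u \in <[Z]>%VS.
    apply: contraT => uZ; have uA := PZA u uPZ uZ.
    have : (0 < cnt A (orth (<[v]> + <[y]>)))%N by apply/card_gt0P; exists u; rewrite inE uA.
    by rewrite C0.
  case/vlineP: uZ => k uE; have k0 : k != 0 by apply: contraNneq u0 => k0; rewrite uE k0 scale0r.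
  have yL : y \in (<[v]> + <[y]>)%VS by rewrite memvE addvSr.
  have := orthP _ _ uL y yL; rewrite uE dotZl => /eqP.
  by rewrite mulf_eq0 (negPf k0) => /eqP.
have bwd y : y \in singulars -> y \notin (<[nu]> + <[v]>)%VS -> dot Z y = 0 -> D v y = 0.
  move=> yX ynv Zy.
  pose t0 := - (dot P y / dot P nu).
  have line_t t : let L := (<[v]> + <[y + t *: nu]>)%VS in \dim L = 2%N /\ nu \notin L.
    move=> L; have ytv : y + t *: nu \notin (<[nu]> + <[v]>)%VS.
      apply: contraNN ynv => yt; rewrite -(addrK (t *: nu) y) memvB //.
      by rewrite memvZ // memvE addvSl.
    split; last by apply: contraNN ytv => nuL; apply: not_nu_in_line.
    by rewrite dim_line2 //; apply: contraNN ytv; apply/subvP; apply: addvSr.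
  (* t0 makes P orthogonal to y + t0 nu, so [orth L] contains the full line on P and Z. It then has
     too many points of A for L to have a second singular point. *)
  have t0_notin s : height (s *: v + y) != t0.
    apply/negP => /eqP ht0; have [dL nuL] := line_t t0.
    have := cnt_singulars_line dL nuL.
    set L := (<[v]> + <[y + t0 *: nu]>)%VS in dL nuL *.
    have PL : P \in orth L.
      rewrite orthD memv_cap !orth_lineE Pv eqxx dotDr dotZr /t0.
      by rewrite mulNr divfK // subrr eqxx.
    have ZL : Z \in orth L.
      by rewrite orthD memv_cap !orth_lineE Zv eqxx dotDr dotZr Zy Znu mulr0 addr0 eqxx.
    have := cnt_full PA PL; rewrite card_vspace_q dim_orth dL -[(5 - 2)%N]/3%N.
    have : (q * q1 <= cnt (full P) (orth L))%N.
      rewrite -(cnt_full_addv PA ZP); apply: subset_leq_card; apply/subsetP => u.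
      rewrite !inE => /andP[-> uPZ] /=; apply: subvP uPZ.
      by rewrite subv_add -!memvE PL.
    have : (2 * q1 <= cnt singulars L)%N.
      have syX : s *: v + (y + t0 *: nu) \in singulars.
        rewrite addrA -ht0; apply: singular_shift.
        apply: contraNN ynv => syn; rewrite -(addKr (s *: v) y) addrC memv_add //.
        by rewrite memvN memvZ ?memv_line.
      apply: (two_singulars vX syX); rewrite ?memvE ?addvSl // -?memvE.
        by rewrite memv_add ?memvZ ?memv_line.
      apply/negP => syv; have : \dim L = 1%N; last by rewrite dL.
      rewrite /L (addv_idPl _) ?dim_vline ?v0 // -memvE.
      by rewrite -(addKr (s *: v) (y + _)) memvD // memvN memvZ ?memv_line.
    move: (cnt (full P) (orth L)) (cnt singulars L) (cnt A (orth L)).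
    by clear; nia.
  (* The line on v and y + t nu has the singular points v and s v + y + t nu  *)
  (* with height (s v + y) = t, and none of the latter for t = t0.  So some   *)
  (* t gives three singular points, hence a line of singular points.          *)
  have : ~~ injectiveb (fun s => height (s *: v + y)).
    apply/negP => /injectiveP /injF_bij[g _ gK].
    by have := t0_notin (g t0); rewrite gK eqxx.
  case/injectivePn => s [s' ss' hss']; set t := height (s *: v + y) in hss'.
  have [dL nuL] := line_t t.
  have inL r : r *: v + (y + t *: nu) \in (<[v]> + <[y + t *: nu]>)%VS.
    by rewrite memv_add ?memvZ ?memv_line.
  have ytv : y + t *: nu \notin <[v]>%VS.
    by apply/negP => yv; move: dL; rewrite (addv_idPl _) ?dim_vline ?v0.
  have singL r : height (r *: v + y) = t -> r *: v + (y + t *: nu) \in singulars.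
    move=> <-; rewrite addrA; apply: singular_shift; apply: contraNN ynv => ryn.
    rewrite -(addKr (r *: v) y) addrC memv_add //.
    by rewrite memvN memvZ ?memv_line.
  have notv r : r *: v + (y + t *: nu) \notin <[v]>%VS.
    apply: contraNN ytv => rv; rewrite -(addKr (r *: v) (y + _)) memvD //.
    by rewrite memvN memvZ ?memv_line.
  have notss' : s' *: v + (y + t *: nu) \notin <[s *: v + (y + t *: nu)]>%VS.
    apply/negP => ss; have : (s' - s) *: v \in <[s *: v + (y + t *: nu)]>%VS.
      have -> : (s' - s) *: v = s' *: v + (y + t *: nu) - (s *: v + (y + t *: nu)).
        by rewrite opprD addrACA subrr addr0 scalerBl.
      by rewrite memvB ?memv_line.
    have ss0 : s' - s != 0 by rewrite subr_eq0 eq_sym.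
    move/(memvZ (s' - s)^-1); rewrite scalerK // => /(vline_sym v0).
    by rewrite (negPf (notv s)).
  have vL : v \in (<[v]> + <[y + t *: nu]>)%VS by rewrite memvE addvSl.
  have allX := (singulars_line_full dL nuL
    (three_singulars vX (singL s erefl) (singL s' (esym hss')) vL (inL s) (inL s')
      (notv s) (notv s') notss')).2.
  have ytL := inL 0; rewrite scale0r add0r in ytL.
  have yt0 : y + t *: nu != 0 by apply: contraNneq ytv => ->; apply: mem0v.
  (* y and y + t nu are both singular, so t = 0, and the line of singular points contains v + y. *)
  have := singular_height (allX _ ytL yt0).
  rewrite height_nu (singular_height yX) add0r => t_eq0.
  rewrite t_eq0 scale0r addr0 in allX ytL ytv.
  have vyX : v + y \in singulars.
    apply: allX; first by rewrite memvD ?memvE ?addvSl -?memvE.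
    apply: contraNneq ytv => /eqP; rewrite addrC addr_eq0 => /eqP ->.
    by rewrite memvN memv_line.
  by rewrite /defect !singular_height // !addr0.
move=> y; have [ynv|ynv] := boolP (y \in (<[nu]> + <[v]>)%VS).
  case/memv_addv_lineP: ynv => _ /vlineP[t ->] [s ->].
  rewrite addrC defect_nu' dotDr !dotZr Zv Znu !mulr0 addr0 eqxx.
  rewrite /defect -[X in X + _ *: _]scale1r -scalerDl !heightZ singular_height //.
  by rewrite !mulr0 !addr0 eqxx.
have ynu : y \notin <[nu]>%VS by apply: contraNN ynv; apply/subvP; apply: addvSl.
have yX := singular_shift ynu.
have ynv' : y + height y *: nu \notin (<[nu]> + <[v]>)%VS.
  apply: contraNN ynv => yh; rewrite -(addrK (height y *: nu) y) memvB //.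
  by rewrite memvZ // memvE addvSl.
rewrite -(defect_nu' v (height y)).
have -> : dot Z y = dot Z (y + height y *: nu) by rewrite dotDr dotZr Znu mulr0 addr0.
by apply/eqP/eqP => [|]; [apply: fwd | apply: bwd].
Qed.

Lemma tangent_hyperplane x : x \notin <[nu]>%VS ->
  exists2 z, z != 0 & forall y, (D x y == 0) = (dot z y == 0).
Proof.
move=> xnu; have [z z0 zE] := tangent_singular (singular_shift xnu).
by exists z => // y; rewrite -zE [in RHS]defectC defect_nu' defectC.
Qed.

Lemma height_comb x y (a b : F) : D x y = 0 ->
  height (a *: x + b *: y) = a * height x + b * height y.
Proof.
move=> xy; rewrite -!heightZ; apply: (c_perpD pchar2).
have perpZ' := perpZ pchar2 heightZ height_nu tangent_hyperplane.
by apply: (perpZ'); rewrite defectC; apply: (perpZ'); rewrite defectC.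
Qed.

Lemma singular_line x y : D x y = 0 -> height x = 0 -> height y = 0 ->
  forall f, f \in (<[x]> + <[y]>)%VS -> height f = 0.
Proof.
move=> xy hx hy f /memv_addv_lineP[_ /vlineP[a ->] [b ->]].
by rewrite height_comb // hx hy !mulr0 addr0.
Qed.

(** * Singular lines in solids *)

Lemma dim_orth_vline a : a != 0 -> \dim (orth <[a]> : {vspace V}) = 4%N.
Proof. by move=> a0; rewrite dim_orth dim_vline a0. Qed.

(** By [cnt_singulars_line], the [orth] of a line of singular points misses A; if the line lay in W,
    a would be in that [orth]. *)
Lemma singular_subspace_disjoint a (W : {vspace V}) : a \in A -> (W <= orth <[a]>)%VS ->
  (forall f, f \in W -> height f = 0) -> (\dim W <= 1)%N.
Proof.
move=> aA Wa hW; rewrite leqNgt; apply/negP => dW.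
have [f fW f0] : exists2 f, f \in W & f \notin 0%VS.
  by apply/subvPn; apply: contraL dW => /dimvS; rewrite dimv0; case: (\dim W).
rewrite memv0 in f0.
have [g gW gf] : exists2 g, g \in W & g \notin <[f]>%VS.
  by apply/subvPn; apply: contraL dW => /dimvS; rewrite dim_vline f0 -ltnNge.
have dL : \dim (<[f]> + <[g]>) = 2%N by rewrite dim_line2.
have LW : (<[f]> + <[g]> <= W)%VS by rewrite subv_add -!memvE fW.
have hL u : u \in (<[f]> + <[g]>)%VS -> height u = 0 by move=> uL; apply: hW; apply: subvP LW _ uL.
have nuL : nu \notin (<[f]> + <[g]>)%VS.
  apply/negP => /hL; rewrite -[nu]add0r -[nu]scale1r height_nu.
  have := heightZ 0 nu; rewrite scale0r mul0r => ->.
  by rewrite add0r => /eqP; rewrite oner_eq0.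
have := cnt_singulars_line dL nuL.
have : (0 < cnt A (orth (<[f]> + <[g]>)))%N.
  apply/card_gt0P; exists a; rewrite inE aA /=.
  by rewrite memvE -[<[a]>%VS]orthK orthSE (subv_trans LW Wa).
have <- : (cnt singulars (<[f]> + <[g]>) = q1 * (q + 1))%N; last first.
  by move: (cnt A _) => C; rewrite -{2}[(h * _)%N]add0n => C_gt0 /addIn C0; rewrite C0 in C_gt0.
have := card_vspaceD (sub0v (<[f]> + <[g]>)); rewrite !card_vspace_q dL dimv0 expn0.
rewrite [cnt _ _](_ : _ = #|[set u in (<[f]> + <[g]>)%VS | u \notin 0%VS]|).
  by move: #|_| => c; clear; lia.
apply: eq_card => u; rewrite [LHS]inE [RHS]inE memv0 andbC.
case uL: (u \in (<[f]> + <[g]>)%VS) => //=; apply/idP/idP => [/singular_neq0 //|u0].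
exact: height0_singular (hL u uL).
Qed.

Lemma exists_singular a : a != 0 -> exists2 v, v \in singulars & v \in orth <[a]>%VS.
Proof.
move=> a0; have da := dim_orth_vline a0.
have [x xa xnu] : exists2 x, x \in orth <[a]>%VS & x \notin <[nu]>%VS.
  by apply/subvPn/negP => /dimvS; rewrite [\dim (orth _)]da dim_vline nu_neq0.
have x0 : x != 0 by apply: contraNneq xnu => ->; apply: mem0v.
have [hx|hx] := eqVneq (height x) 0; first by exists x => //; apply: height0_singular.
have [z z0 zE] := tangent_hyperplane xnu.
have [y yaz yx] : exists2 y, y \in orth (<[a]> + <[z]>)%VS & y \notin <[x]>%VS.
  apply/subvPn/negP => /dimvS; rewrite [\dim (orth _)]dim_orth dim_vline x0.
  have := (dimv_add_leqif <[a]> <[z]>).1; rewrite !dim_vline a0 z0.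
  by move: (\dim _) => d; clear; lia.
move: yaz; rewrite orthD memv_cap orth_lineE dotC => /andP[/eqP ay].
rewrite orth_lineE dotC -zE => /eqP xy.
(* As x and y are orthogonal, the height is a sum of two equal terms, zero in characteristic 2. *)
exists (height y *: x + height x *: y).
  apply: height0_singular; last by rewrite height_comb // mulrC (addrr_pchar2 pchar2).
  apply: contraNneq yx => /eqP; rewrite addrC addr_eq0 -scaleNr => /eqP yE.
  by rewrite -(scalerK hx y) yE !memvZ ?memv_line.
by rewrite memvD ?memvZ // orth_lineE dotC ay.
Qed.

Lemma defect_v_nu x : D x nu = 0.
Proof. by rewrite -[nu]scale1r -[_ *: nu]add0r defect_nu' (defect0 pchar2 heightZ). Qed.

Lemma tangent_line_secant (v y : V) : v \in singulars -> y \notin <[v]>%VS -> D v y = 0 ->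
    height y != 0 -> nu \notin (<[v]> + <[y]>)%VS ->
  cnt A (orth (<[v]> + <[y]>)) = w.
Proof.
move=> vX yv vy hy nuL; have v0 := singular_neq0 vX.
have dL : \dim (<[v]> + <[y]>) = 2%N by rewrite dim_line2.
have := cnt_singulars_line dL nuL.
have -> : cnt singulars (<[v]> + <[y]>) = q1.
  rewrite -(card_punctured v0); apply: eq_card => f; rewrite [LHS]inE [RHS]inE memv0.
  apply/andP/andP => [[fX /memv_addv_lineP[_ /vlineP[s ->] [b fE]]]|[/vlineP[s ->] sv0]].
    split; last exact: singular_neq0.
    have := singular_height fX; rewrite fE height_comb // (singular_height vX) mulr0 add0r.
    move/eqP; rewrite mulf_eq0 (negPf hy) orbF => /eqP ->.
    by rewrite scale0r addr0 memvZ ?memv_line.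
  split; last by rewrite memvZ // memvE addvSl.
  by apply: singularsZ => //; apply: contraNneq sv0 => ->; rewrite scale0r.
move: (cnt A _) => C; clear; lia.
Qed.

(** If the solid contains nu, two orthogonal vectors of it become singular after shifts along nu.
    Otherwise the line is sought through a singular v of the solid, in the plane U cut out by the
    tangent hyperplane of v. *)
Lemma nonelliptic_line a : a != 0 -> a \notin A ->
  exists2 W : {vspace V}, \dim W = 2%N &
    (W <= orth <[a]>)%VS /\ forall f, f \in W -> height f = 0.
Proof.
move=> a0 aA; have da := dim_orth_vline a0.
have [nua|nua] := boolP (nu \in orth <[a]>%VS).
  have [x xa xnu] : exists2 x, x \in orth <[a]>%VS & x \notin <[nu]>%VS.
    by apply/subvPn/negP => /dimvS; rewrite [\dim (orth _)]da dim_vline nu_neq0.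
  have [z z0 zE] := tangent_hyperplane xnu.
  have dnx : \dim (<[nu]> + <[x]>) = 2%N by rewrite dim_line2 ?nu_neq0.
  have [y yaz ynx] : exists2 y, y \in orth (<[a]> + <[z]>)%VS & y \notin (<[nu]> + <[x]>)%VS.
    apply/subvPn/negP => /dimvS; rewrite [\dim (orth _)]dim_orth dnx.
    have := (dimv_add_leqif <[a]> <[z]>).1; rewrite !dim_vline a0 z0.
    by move: (\dim _) => d; clear; lia.
  move: yaz; rewrite orthD memv_cap => /andP[ya]; rewrite orth_lineE dotC -zE => /eqP xy.
  pose x' := x + height x *: nu; pose y' := y + height y *: nu.
  have x'X : x' \in singulars by apply: singular_shift.
  have ynu : y \notin <[nu]>%VS by apply: contraNN ynx; apply/subvP; apply: addvSl.
  have y'X : y' \in singulars by apply: singular_shift.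
  have x'y' : D x' y' = 0 by rewrite defect_nu' defectC defect_nu' defectC.
  exists (<[x']> + <[y']>)%VS.
    rewrite dim_line2 ?singular_neq0 //; apply: contraNN ynx => /vlineP[k yE].
    have -> : y = (k * height x - height y) *: nu + k *: x.
      rewrite -[LHS](addrK (height y *: nu)) -/y' yE /x' scalerDr scalerA scalerBl.
      by rewrite -addrA addrC.
    by rewrite memv_add ?memvZ ?memv_line.
  split; last by apply: singular_line; rewrite ?singular_height.
  by rewrite subv_add -!memvE !memvD ?memvZ.
have [v vX va] := exists_singular a0.
have v0 := singular_neq0 vX.
have [z z0 zE] := tangent_hyperplane (singular_not_nu vX).
have znu : dot z nu = 0 by apply/eqP; rewrite -zE defect_v_nu.
have zv : dot z v = 0 by apply/eqP; rewrite -zE (defect_id pchar2 heightZ).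
have nua' : dot nu a != 0 by rewrite -orth_lineE.
have za : z \notin <[a]>%VS.
  apply/negP => /vlineP[k kE]; move: znu; rewrite kE dotZl dotC => /eqP.
  rewrite mulf_eq0 (negPf nua') orbF => /eqP k0.
  by move: z0; rewrite kE k0 scale0r eqxx.
pose U := orth (<[a]> + <[z]>).
have daz : \dim (<[a]> + <[z]>) = 2%N by rewrite dim_line2.
have dU : \dim U = 3%N by rewrite dim_orth daz.
have vU : v \in U by rewrite /U orthD memv_cap va orth_lineE dotC zv eqxx.
have Uperp y : y \in U -> D v y = 0.
  by rewrite /U orthD memv_cap orth_lineE => /andP[_]; rewrite orth_lineE dotC -zE => /eqP.
have UP y : y \in U -> (<[v]> + <[y]> <= orth <[a]>)%VS.
  by rewrite /U orthD memv_cap => /andP[ya _]; rewrite subv_add -!memvE va.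
have [y /and3P[yU yv /eqP hy]|nosing] :=
    pickP [pred y | [&& y \in U, y \notin <[v]>%VS & height y == 0]].
  exists (<[v]> + <[y]>)%VS; first by rewrite dim_line2.
  split; first exact: UP.
  by apply: singular_line => //; [apply: Uperp | apply: singular_height].
(* Now v is the only singular point of every line on v in the plane U; the   *)
(* number of points of A orthogonal to v then forces all points of orth U    *)
(* other than z, in particular a, into A.                                    *)
exfalso; pose B := [set x in A | x \in orth <[v]>%VS].
have cardB : #|B| = small by move: vX; rewrite inE => /andP[_ /eqP].
have cntB y : cnt B (orth <[y]>) = cnt A (orth (<[v]> + <[y]>)).
  by apply: eq_card => x; rewrite !inE orthD memv_cap andbA.
have cntBin y : y \in <[v]>%VS -> cnt B (orth <[y]>) = (w * q1)%N.
  rewrite cntB -cardB => yv; rewrite (addv_idPl _) -?memvE //.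
have cntBout y : y \in U -> y \notin <[v]>%VS -> cnt B (orth <[y]>) = w.
  move=> yU yv; rewrite cntB; apply: tangent_line_secant => //; first exact: Uperp.
    by apply/negP => hy; have := nosing y; rewrite /= yU yv hy.
  by apply: contraNN nua; apply/subvP; apply: UP.
have := sum_cnt_orth B U.
have -> : (\sum_(f in U) cnt B (orth <[f]>) = q * (w * q1) + (q ^ 3 - q) * w)%N.
  rewrite (bigID (fun f => f \in <[v]>%VS)) /=; congr (_ + _)%N.
    rewrite (eq_bigr (fun _ => (w * q1)%N)); last by move=> y /andP[_]; apply: cntBin.
    rewrite sum_nat_const; congr (_ * _)%N.
    have <- : #|<[v]>%VS| = q by rewrite card_vspace_q dim_vline v0 expn1.
    apply: eq_card => y; rewrite [LHS]unfold_in andb_idl // => yv.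
    by case/vlineP: yv => k ->; rewrite memvZ.
  rewrite (eq_bigr (fun _ => w)); last by move=> y /andP[]; apply: cntBout.
  rewrite sum_nat_const; congr (_ * _)%N.
  have svU : (<[v]> <= U)%VS by rewrite -memvE.
  have := card_vspaceD svU; rewrite !card_vspace_q dU dim_vline v0 expn1 => <-.
  by rewrite addnK; apply: eq_card => y; rewrite [LHS]unfold_in !inE.
rewrite cardB card_vspace_q dU card_F orthK => E.
have cB : cnt B (<[a]> + <[z]>) = (q * q1)%N.
  have q3 : (q ^ 3 - q = q * q1 * (q + 1))%N by clear; lia.
  apply/eqP; rewrite -(@eqn_pmul2l (q ^ 3 * q1)) ?muln_gt0 ?expn_gt0 //; apply/eqP.
  move: E; rewrite q3; move: (cnt B _) => d; clear; lia.
have sub : [set u in B | u \in (<[a]> + <[z]>)%VS] \subset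
    [set u in (<[a]> + <[z]>)%VS | u \notin <[z]>%VS].
  apply/subsetP => u; rewrite !inE => /andP[/andP[uA _] ->] /=.
  by apply/negP => /vlineP[k uE]; move: (mem_zeros_nu uA); rewrite uE dotZl znu mulr0 eqxx.
have /eqP eqL : [set u in B | u \in (<[a]> + <[z]>)%VS] ==
    [set u in (<[a]> + <[z]>)%VS | u \notin <[z]>%VS].
  rewrite eqEcard sub [#|[set u in B | _]|]cB.
  have := card_vspaceD (addvSr <[a]> <[z]>); rewrite !card_vspace_q daz dim_vline z0.
  by rewrite expn1; move: #|_| => c; clear; lia.
have : a \in [set u in (<[a]> + <[z]>)%VS | u \notin <[z]>%VS].
  rewrite inE memvE addvSl /=; apply: contraNN za; exact: vline_sym.
by rewrite -eqL !inE (negPf aA).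
Qed.

(** * The quadratic form and its sections *)

Definition form (x : V) : F := height x ^+ 2.

Lemma sqrD_pchar2 (s t : F) : (s + t) ^+ 2 = s ^+ 2 + t ^+ 2.
Proof. by rewrite sqrrD mulr2n (addrr_pchar2 pchar2) addr0. Qed.

Lemma polar_form x y : polar form x y = D x y ^+ 2.
Proof. by rewrite /polar /form /defect !sqrD_pchar2 !(oppr_pchar2 pchar2). Qed.

Lemma form_quadratic : @quadratic_form F 4 form.
Proof.
split=> [a v|u]; first by rewrite /form heightZ exprMn.
move=> a x y; rewrite !polar_form.
rewrite (defectDr pchar2 heightZ height_nu _ tangent_hyperplane) // sqrD_pchar2.
have [b ->] := sqr_onto pchar2 a.
by rewrite (defectZr pchar2 heightZ height_nu _ tangent_hyperplane) // exprMn.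
Qed.

Lemma form_eq0 x : (form x == 0) = (height x == 0).
Proof. by rewrite sqrf_eq0. Qed.

Lemma form_nonsingular : @nonsingular_on F 4 fullv form.
Proof.
move=> v _ /eqP; rewrite form_eq0 => /eqP hv perpv; apply/eqP/negPn/negP => v0.
have [z z0 zE] := tangent_hyperplane (singular_not_nu (height0_singular v0 hv)).
have : z \in orth (orth (0%VS : {vspace V})).
  apply/orthP => u _; apply/eqP; rewrite -zE -sqrf_eq0 -polar_form.
  by rewrite perpv ?memvf.
by rewrite orthK memv0 (negPf z0).
Qed.

(** The tangent hyperplane of a singular radical vector would be the solid of a; but it contains nu,
    and the solid of a in A does not. *)
Lemma form_nonsingular_solid a : a \in A -> @nonsingular_on F 4 (orth <[a]>) form.
Proof.
move=> aA v va /eqP; rewrite form_eq0 => /eqP hv perpv; apply/eqP/negPn/negP => v0.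
have [z z0 zE] := tangent_hyperplane (singular_not_nu (height0_singular v0 hv)).
have : z \in orth (orth <[a]>).
  apply/orthP => u ua; apply/eqP; rewrite -zE -sqrf_eq0 -polar_form.
  by rewrite perpv.
rewrite orthK => /vlineP[k kE]; have := zE nu; rewrite defect_v_nu eqxx kE dotZl.
rewrite mulf_eq0 (negPf (mem_zeros_nu aA)) orbF => /esym/eqP k0.
by move: z0; rewrite kE k0 scale0r eqxx.
Qed.

Lemma totally_singularP (Q : V -> F) (W : {vspace V}) :
  reflect {in W, forall v, Q v = 0} (@totally_singular F 4 Q W).
Proof.
apply: (iffP forallP) => [QW v vW|QW v].
  by apply/eqP; have := QW v; rewrite vW.
by apply/implyP => vW; rewrite QW.
Qed.

Lemma section_quadric (S : {vspace V}) :
  section (@quadric F 4 fullv form) S = @quadric F 4 S form.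
Proof. by apply/setP => P; rewrite !inE subvf /= -andbA; congr (_ && _); apply: andbC. Qed.

Lemma quadric_structure : exists X : {set {vspace V}}, nonsingular_quadric X /\
  forall a, a != 0 -> a \in A <-> elliptic_quadric (orth <[a]>) (section X (orth <[a]>)).
Proof.
exists (@quadric F 4 fullv form); split.
  by exists form; split; [apply: form_quadratic | apply: form_nonsingular |].
move=> a a0; split=> [aA|[_ [Q' [Q'form _ wittQ' secE]]]].
  split; first by rewrite /solid dim_orth_vline.
  exists form; split; [exact: form_quadratic | exact: form_nonsingular_solid | |].
    apply/eqP; rewrite eqn_leq; apply/andP; split.
      apply/bigmax_leqP => W /andP[Wa /totally_singularP Wsing].
      apply: (singular_subspace_disjoint aA Wa) => f fW.
      by apply/eqP; rewrite -form_eq0 Wsing.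
    have [v vX va] := exists_singular a0.
    have dv : \dim <[v]> = 1%N by rewrite dim_vline singular_neq0.
    rewrite -[X in (X <= _)%N]dv; apply: leq_bigmax_cond.
    rewrite -memvE va; apply/totally_singularP => _ /vlineP[k ->].
    by apply/eqP; rewrite form_eq0 heightZ singular_height // mulr0.
  exact: section_quadric.
(* The points of the section determine the totally singular subspaces, so W is totally singular for
   Q' as well. *)
apply: contraT => aA; have [W dW [Wa Wsing]] := nonelliptic_line a0 aA.
suff : (\dim W <= @witt_index F 4 (orth <[a]>) Q')%N by rewrite wittQ' dW.
apply: leq_bigmax_cond; rewrite Wa; apply/totally_singularP => f fW.
have [->|f0] := eqVneq f 0.
  by rewrite -(scale0r 0) Q'form.1 expr0n mul0r.
have : <[f]>%VS \in @quadric F 4 (orth <[a]>) Q'.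
  rewrite -secE section_quadric inE /point dim_vline f0 -memvE (subvP Wa) //=.
  apply/totally_singularP => _ /vlineP[k ->].
  by apply/eqP; rewrite form_eq0 heightZ Wsing // mulr0.
by rewrite inE => /and3P[_ _ /totally_singularP]; apply; apply: memv_line.
Qed.

End Quadric.

Lemma hyperoval_or_quadric : 2 \in [pchar F] ->
  (exists (W : {vspace V}) (H : {set {vspace V}}), hyperoval W H /\
     forall a, a != 0 -> a \in A <-> section H (orth <[a]>) = set0)
  \/ (exists X : {set {vspace V}}, nonsingular_quadric X /\
     forall a, a != 0 -> a \in A <-> elliptic_quadric (orth <[a]>) (section X (orth <[a]>))).
Proof.
move=> pchar2; have [P PA] := exists_A; have [fullE|fullE] := card_full PA; [left|right].
  by apply: hyperoval_structure; rewrite (card_A (d := 0) PA fullE) // addn0.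
have card_A1 := card_A (d := 1) PA fullE isT.
have [nu nuZ] : exists nu, nu \in zeros.
  by apply/card_gt0P; rewrite (card_zeros (r := q1) card_A1) //; right.
exact: quadric_structure card_A1 pchar2 nu nuZ.
Qed.

End TwoIntersection.

Lemma even_card_pchar2 (F : finFieldType) : ~~ odd #|F| -> 2 \in [pchar F].
Proof.
move=> q_even; rewrite inE /= mulr2n addr_eq0 eq_sym.
by rewrite -[- 1](expf_card (- 1 : F)) -signr_odd (negPf q_even) expr0.
Qed.

(** * Solids and their normal vectors *)

Section Normals.

Variables (F : finFieldType) (e : nat) (E : {set {vspace 'rV[F]_5}}).
Hypothesis card_F : #|F| = (2 * e).+2.
Hypothesis E_solids : {in E, forall S, solid S}.
Notation V := 'rV[F]_5.

Definition normals := [set a : V | (a != 0) && (orth <[a]> \in E)].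

Lemma normals0 : 0 \notin normals.
Proof. by rewrite inE eqxx. Qed.

Lemma normalsZ (a : F) (x : V) : a != 0 -> x \in normals -> a *: x \in normals.
Proof.
move=> a0; rewrite !inE => /andP[x0 xE].
by rewrite vline_scale // xE scaler_eq0 negb_or a0 x0.
Qed.

Lemma solid_orth (S : {vspace V}) : solid S -> exists2 a, a != 0 & S = orth <[a]>.
Proof.
move=> /eqP dS; have dS1 : \dim (orth S) = 1%N by rewrite dim_orth dS.
have a0 : vpick (orth S) != 0 by rewrite vpick0 -dimv_eq0 dS1.
exists (vpick (orth S)) => //; rewrite -[LHS]orthK; congr orth.
apply/esym/eqP; rewrite eqEdim dS1 dim_vline a0 leqnn andbT -memvE.
exact: memv_pick.
Qed.

(** Each solid has q - 1 normals, and they lie in U iff the solid contains [orth U]. This turns the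
    conditions on points and planes into conditions on hyperplanes and lines of the dual space. *)
Lemma cnt_normals (U : {vspace V}) :
  cnt normals U = ((2 * e).+1 * #|[set S in E | (orth U <= S)%VS]|)%N.
Proof.
have Z0 : 0 \notin [set a in normals | a \in U] by rewrite inE negb_and normals0.
have ZZ (a : F) f : a != 0 -> f \in [set a in normals | a \in U] ->
    a *: f \in [set a in normals | a \in U].
  move=> a0; rewrite inE => /andP[fE fU]; rewrite inE memvZ // andbT.
  exact: normalsZ.
have gE (f f' : V) : orth <[f]> = orth <[f']> <-> <[f]>%VS = <[f']>%VS.
  by split=> [/orth_inj|->].
rewrite /cnt (card_vline_image card_F Z0 ZZ gE) mulnC; congr (_ * _)%N.
apply: eq_card => S; rewrite [RHS]inE; apply/imsetP/andP => [[a + ->]|[SE US]].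
  by rewrite !inE => /andP[/andP[_ aE] aU]; rewrite aE orthSE -memvE.
have [a a0 Sa] := solid_orth (E_solids SE); exists a => //.
by rewrite !inE a0 -Sa SE memvE -orthSE -Sa.
Qed.

End Normals.

Local Close Scope ring_scope.

Theorem theorem1p1 (F : finFieldType) (q : nat) (card_F : #|F| = q)
    (q_gt2 : 2 < q) (q_even : ~~ odd q)
    (E : {set {vspace 'rV[F]_5}})
    (E_solids : {in E, forall S, solid S}) (E_neq0 : E != set0)
    (pointsE : forall P : {vspace 'rV[F]_5}, point P ->
       #|[set S in E | (P <= S)%VS]|
         \in [:: 0; q ^ 3 %/ 2; (q ^ 3 - q ^ 2) %/ 2])
    (planesE : forall W : {vspace 'rV[F]_5}, plane W ->
       #|[set S in E | (W <= S)%VS]| \in [:: 0; q %/ 2; q]) :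
  (exists (W : {vspace 'rV[F]_5}) (H : {set {vspace 'rV[F]_5}}),
     hyperoval W H /\
     forall S : {vspace 'rV[F]_5}, S \in E <-> solid S /\ section H S = set0)
  \/
  (exists X : {set {vspace 'rV[F]_5}}, nonsingular_quadric X /\
     forall S : {vspace 'rV[F]_5},
       S \in E <-> solid S /\ elliptic_quadric S (section X S)).
Proof.
have pchar2 : (2 \in [pchar F])%R by apply: even_card_pchar2; rewrite card_F.
have [e e_gt0 qE] : exists2 e, 0 < e & q = (2 * e).+2.
  by exists (q./2).-1; lia.
have cardFe : #|F| = (2 * e).+2 by rewrite card_F.
(* With q = 2 (e + 1), the quotients in the hypotheses become products. *)
have half3 : q ^ 3 %/ 2 = e.+1 * q * q.
  by rewrite -[RHS](@mulKn _ 2) //; congr (_ %/ _); rewrite qE; lia.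
have half32 : (q ^ 3 - q ^ 2) %/ 2 = e.+1 * q * (2 * e).+1.
  rewrite -[RHS](@mulKn _ 2) //; congr (_ %/ _); rewrite expnS -{2}[q ^ 2]mul1n -mulnBl qE; lia.
have half1 : q %/ 2 = e.+1 by lia.
have normals_neq0 : normals E != set0.
  have [S SE] := set0Pn _ E_neq0; have [a a0 Sa] := solid_orth (E_solids S SE).
  by apply/set0Pn; exists a; rewrite inE a0 -Sa SE.
have hyperplanes (f : 'rV[F]_5) : f != 0%R -> cnt (normals E) (orth <[f]>) \in
    [:: 0; (2 * e).+1 * e.+1 * (2 * e).+2 * (2 * e).+2;
           (2 * e).+1 * e.+1 * (2 * e).+2 * (2 * e).+1].
  move=> f0; have := pointsE <[f]>%VS; rewrite /point dim_vline f0 => /(_ isT).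
  rewrite half3 half32 qE (cnt_normals cardFe) // orthK !inE.
  by case/or3P => /eqP ->; rewrite ?muln0 ?mulnA eqxx ?orbT.
have lines (L : {vspace 'rV[F]_5}) : \dim L = 2 -> cnt (normals E) L \in
    [:: 0; (2 * e).+1 * e.+1; (2 * e).+1 * (2 * e).+2].
  move=> dL; have := planesE (orth L); rewrite /plane dim_orth dL => /(_ isT).
  rewrite half1 qE (cnt_normals cardFe) // !inE.
  by case/or3P => /eqP ->; rewrite ?muln0 ?eqxx ?orbT.
have transfer (P : {vspace 'rV[F]_5} -> Prop) :
    (forall a : 'rV[F]_5, a != 0%R -> a \in normals E <-> P (orth <[a]>)) ->
    forall S, S \in E <-> solid S /\ P S.
  move=> PE S; split=> [SE|[/solid_orth[a a0 ->] Pa]].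
    have [a a0 Sa] := solid_orth (E_solids S SE).
    by split; [apply: E_solids | rewrite Sa; apply/PE => //; rewrite inE a0 -Sa].
  by move/(PE a a0): Pa; rewrite inE => /andP[].
have [[W [H [HW HE]]]|[X [XQ XE]]] := hyperoval_or_quadric cardFe e_gt0 (normals0 E)
  (@normalsZ F E) normals_neq0 hyperplanes lines pchar2.
  by left; exists W, H; split=> //; apply: transfer HE.
by right; exists X; split=> //; apply: transfer XE.
Qed.
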